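(* Let $\Gamma\subset\mathbb{R}^2\cong\mathbb{C}$ be a Jordan $\mathcal{C}^1$-curve and let $T$ be a non-flat triangle in the plane, with vertices $(A,B,C)$. Then there exist a translation $\tau$ and a homothety $\eta$ with positive ratio such that the three vertices $\eta\tau(A),\eta\tau(B),\eta\tau(C)$ all lie on $\Gamma$.
   Context: A Jordan $\mathcal{C}^1$-curve is a connected closed (compact, boundaryless) $\mathcal{C}^1$-submanifold of the plane; equivalently, the image of an injective $\mathcal{C}^1$-immersion of the unit circle $S^1$ into the plane. A triangle (ordered triple of points of the plane) is flat if its vertices are contained in a straight line. *)

(* Defs.v *)
From Stdlib Require Export Reals.
Open Scope R_scope.

Definition point := (R * R)%type.

Definition padd (p q : point) : point := (fst p + fst q, snd p + snd q).
Definition psub (p q : point) : point := (fst p - fst q, snd p - snd q).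
Definition pscale (r : R) (p : point) : point := (r * fst p, r * snd p).

Definition on_line (a b c : R) (p : point) : Prop := a * fst p + b * snd p = c.

Definition flat (A B C : point) : Prop :=
  exists a b c : R, (a <> 0 \/ b <> 0) /\
    on_line a b c A /\ on_line a b c B /\ on_line a b c C.

(* A C^1 immersion of S^1 = R/Z into the plane, given as a 1-periodic map
   gamma : R -> R^2 whose coordinates are C^1 with nowhere vanishing
   velocity, and which is injective on S^1 (i.e. on [0,1)). *)
Definition injective_C1_immersion_S1 (g1 g2 : R -> R) : Prop :=
  (forall t, g1 (t + 1) = g1 t /\ g2 (t + 1) = g2 t) /\
  (exists d1 d2 : R -> R,
     (forall t, derivable_pt_lim g1 t (d1 t)) /\
     (forall t, derivable_pt_lim g2 t (d2 t)) /\
     continuity d1 /\ continuity d2 /\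
     (forall t, d1 t <> 0 \/ d2 t <> 0)) /\
  (forall s t, 0 <= s < 1 -> 0 <= t < 1 ->
     g1 s = g1 t -> g2 s = g2 t -> s = t).

Definition jordan_C1_curve (Gamma : point -> Prop) : Prop :=
  exists g1 g2 : R -> R, injective_C1_immersion_S1 g1 g2 /\
    forall p : point, Gamma p <-> exists t : R, p = (g1 t, g2 t).

Definition translation (v : point) (p : point) : point := padd p v.
Definition homothety (c : point) (r : R) (p : point) : point :=
  padd c (pscale r (psub p c)).

(* Main.v *)
From Stdlib Require Import ZArith Reals Lra Lia Ring Bool ClassicalEpsilon.
From Coquelicot Require Import Coquelicot.
Require Import Defs.
Open Scope R_scope.

(** After a linear change of coordinates the triangle is (0, e1, e2). The chord
    from the parameter s to s + t, divided by t (1 - t), is a continuous nonzero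
    vector W(s, t) on the strip 0 <= t <= 1 (tangent vectors at the ends), so it
    has a continuous angle th. Since W(s + t, 1 - t) = - W(s, t), there is an odd
    multiple k of PI with th(s, 1) = th(s, 0) + k and th(s + 1, t) = th(s, t) + 2 k.
    One looks for chords of direction 0 and PI/2 with the same origin s and the
    same length. The level lines of th at 0 and at PI/2, drawn in the half plane
    with coordinates (s, length), have interleaved ends on the boundary line, and
    must cross. To make "interleaved" literal, u = th / (2 k) is continued on a
    collar -1 <= t <= 0 and 1 <= t <= 2, where the length is taken negative, until
    it becomes s at t = -1 and s + 1/2 at t = 2. The crossing is then a mod 2
    Sperner count on a three-dimensional grid. *)

(** * A Sperner lemma on a box grid, counting modulo 2 *)

(** Booleans serve as parities and [xorb] as addition modulo 2, so that cancelling shared faces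
    becomes a [ring] identity. *)
Fixpoint xsum (n : nat) (f : nat -> bool) : bool :=
  match n with O => false | S m => xorb (xsum m f) (f m) end.

Lemma xsum_ext n f g :
  (forall i, (i < n)%nat -> f i = g i) -> xsum n f = xsum n g.
Proof.
  induction n as [|n IH]; intros H; simpl; [reflexivity|].
  rewrite IH by (intros; apply H; lia). rewrite (H n) by lia. reflexivity.
Qed.

Lemma xsum_false n f : (forall i, (i < n)%nat -> f i = false) -> xsum n f = false.
Proof.
  induction n as [|n IH]; intros H; simpl; [reflexivity|].
  rewrite IH by (intros; apply H; lia). now rewrite (H n) by lia.
Qed.

Lemma xsum_xorb n f g :
  xsum n (fun i => xorb (f i) (g i)) = xorb (xsum n f) (xsum n g).
Proof. induction n as [|n IH]; simpl; [reflexivity|]. rewrite IH. ring. Qed.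

Lemma xsum_telescope n f :
  xsum n (fun i => xorb (f i) (f (S i))) = xorb (f O) (f n).
Proof. induction n as [|n IH]; simpl; [ring|]. rewrite IH. ring. Qed.

Lemma xsum_exchange n m (f : nat -> nat -> bool) :
  xsum n (fun i => xsum m (f i)) = xsum m (fun j => xsum n (fun i => f i j)).
Proof.
  induction n as [|n IH]; simpl.
  - symmetry. now apply xsum_false.
  - rewrite IH. symmetry. apply (xsum_xorb m _ (f n)).
Qed.

Lemma xsum_single n f i0 :
  (i0 < n)%nat -> (forall i, (i < n)%nat -> i <> i0 -> f i = false) ->
  xsum n f = f i0.
Proof.
  induction n as [|n IH]; intros Hi H; [lia|]. simpl.
  destruct (Nat.eq_dec i0 n) as [->|Hn].
  - rewrite xsum_false; [apply xorb_false_l|]. intros; apply H; lia.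
  - rewrite IH; [|lia|intros; apply H; lia].
    rewrite (H n) by lia. apply xorb_false_r.
Qed.

Lemma xsum_ends m f :
  (forall i, (0 < i < S m)%nat -> f i = false) ->
  xsum (S (S m)) f = xorb (f O) (f (S m)).
Proof.
  intros H. change (xsum (S (S m)) f) with (xorb (xsum (S m) f) (f (S m))).
  rewrite (xsum_single (S m) f O); [reflexivity|lia|intros; apply H; lia].
Qed.

Inductive label := L0 | L1 | L2 | L3.

Definition edge12 (a b : label) : bool :=
  match a, b with L1, L2 | L2, L1 => true | _, _ => false end.

Definition tri012 (a b c : label) : bool :=
  match a, b, c with
  | L0, L1, L2 | L0, L2, L1 | L1, L0, L2
  | L1, L2, L0 | L2, L0, L1 | L2, L1, L0 => true
  | _, _, _ => false
  end.

Definition misses (l a b c d : label) : Prop :=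
  l <> a /\ l <> b /\ l <> c /\ l <> d.

(** If the missed label is [L0], [L1] or [L2], no face is complete. If it is [L3], only three labels
    are available for four vertices, and the complete faces number zero or two. *)
Lemma tetrahedron_parity l a b c d :
  misses l a b c d ->
  xorb (xorb (tri012 a b c) (tri012 a b d)) (xorb (tri012 a c d) (tri012 b c d))
  = false.
Proof.
  intros (H1 & H2 & H3 & H4).
  destruct l, a, b, c, d; try reflexivity; exfalso; congruence.
Qed.

(** The square is cut along the diagonal from [a] to [d], because this is the trace of the Kuhn
    tetrahedra on the faces of a cube. *)
Definition square012 (a b c d : label) : bool :=
  xorb (tri012 a b d) (tri012 a c d).

(* The cube is cut into the six Kuhn tetrahedra around its main diagonal. *)
Lemma cube_parity l a000 a100 a010 a110 a001 a101 a011 a111 :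
  l <> a000 -> l <> a100 -> l <> a010 -> l <> a110 ->
  l <> a001 -> l <> a101 -> l <> a011 -> l <> a111 ->
  xorb (xorb (square012 a000 a010 a001 a011) (square012 a100 a110 a101 a111))
 (xorb (xorb (square012 a000 a100 a001 a101) (square012 a010 a110 a011 a111))
       (xorb (square012 a000 a100 a010 a110) (square012 a001 a101 a011 a111)))
  = false.
Proof.
  intros.
  assert (T1 := tetrahedron_parity l a000 a100 a110 a111 ltac:(repeat split; auto)).
  assert (T2 := tetrahedron_parity l a000 a100 a101 a111 ltac:(repeat split; auto)).
  assert (T3 := tetrahedron_parity l a000 a010 a110 a111 ltac:(repeat split; auto)).
  assert (T4 := tetrahedron_parity l a000 a010 a011 a111 ltac:(repeat split; auto)).
  assert (T5 := tetrahedron_parity l a000 a001 a101 a111 ltac:(repeat split; auto)).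
  assert (T6 := tetrahedron_parity l a000 a001 a011 a111 ltac:(repeat split; auto)).
  (* In the sum of the six parities each inner triangle occurs twice and cancels; the twelve
     triangles on the surface remain. *)
  assert (E := f_equal2 xorb (f_equal2 xorb (f_equal2 xorb T1 T2) (f_equal2 xorb T3 T4))
                 (f_equal2 xorb T5 T6)).
  simpl in E. rewrite <- E. unfold square012. ring.
Qed.

(** Summing [cube_parity] over all cells, a face shared by two cells counts twice. Telescoping along
    each of the three axes leaves the six outer faces. *)
Lemma grid_parity (n1 n2 n3 : nat) (lab : nat -> nat -> nat -> label) :
  (forall i j k, (i < n1)%nat -> (j < n2)%nat -> (k < n3)%nat ->
     exists l, forall i' j' k', (i <= i' <= S i)%nat -> (j <= j' <= S j)%nat ->
       (k <= k' <= S k)%nat -> l <> lab i' j' k') ->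
  let qx i j k := square012 (lab i j k) (lab i (S j) k) (lab i j (S k)) (lab i (S j) (S k)) in
  let qy j i k := square012 (lab i j k) (lab (S i) j k) (lab i j (S k)) (lab (S i) j (S k)) in
  let qz k i j := square012 (lab i j k) (lab (S i) j k) (lab i (S j) k) (lab (S i) (S j) k) in
  xorb (xsum n2 (fun j => xsum n3 (fun k => xorb (qx O j k) (qx n1 j k))))
 (xorb (xsum n1 (fun i => xsum n3 (fun k => xorb (qy O i k) (qy n2 i k))))
       (xsum n1 (fun i => xsum n2 (fun j => xorb (qz O i j) (qz n3 i j))))) = false.
Proof.
  intros H qx qy qz.
  assert (E : xsum n1 (fun i => xsum n2 (fun j => xsum n3 (fun k =>
     xorb (xorb (qx i j k) (qx (S i) j k))
    (xorb (xorb (qy j i k) (qy (S j) i k)) (xorb (qz k i j) (qz (S k) i j)))))) = false).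
  { apply xsum_false; intros i Hi. apply xsum_false; intros j Hj.
    apply xsum_false; intros k Hk.
    destruct (H i j k Hi Hj Hk) as [l Hl].
    unfold qx, qy, qz. apply (cube_parity l); apply Hl; lia. }
  rewrite <- E. clear E H.
  symmetry. etransitivity; [apply (xsum_ext n1 _ (fun i =>
    xorb (xsum n2 (fun j => xsum n3 (fun k => xorb (qx i j k) (qx (S i) j k))))
   (xorb (xsum n3 (fun k => xorb (qy O i k) (qy n2 i k)))
         (xsum n2 (fun j => xorb (qz O i j) (qz n3 i j)))))); intros i _|].
  - etransitivity; [apply (xsum_ext n2 _ (fun j =>
      xorb (xsum n3 (fun k => xorb (qx i j k) (qx (S i) j k)))
     (xorb (xsum n3 (fun k => xorb (qy j i k) (qy (S j) i k)))
           (xorb (qz O i j) (qz n3 i j))))); intros j _|].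
    + etransitivity; [apply xsum_xorb|f_equal].
      etransitivity; [apply xsum_xorb|f_equal].
      apply (xsum_telescope n3 (fun k => qz k i j)).
    + etransitivity; [apply xsum_xorb|f_equal].
      etransitivity; [apply xsum_xorb|f_equal].
      rewrite xsum_exchange. apply xsum_ext; intros k _.
      apply (xsum_telescope n2 (fun j => qy j i k)).
  - etransitivity; [apply xsum_xorb|f_equal; [|apply xsum_xorb]].
    rewrite xsum_exchange. apply xsum_ext; intros j _.
    rewrite xsum_exchange. apply xsum_ext; intros k _.
    apply (xsum_telescope n1 (fun i => qx i j k)).
Qed.

(** * Labelling by signs, and cells that contain no zero *)

Definition sign_label (a b c : R) : label :=
  if Rlt_dec a 0 then L0 else if Rlt_dec b 0 then L1 else
  if Rlt_dec c 0 then L2 else L3.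

Lemma sign_label_0 a b c : a < 0 -> sign_label a b c = L0.
Proof. intros H. unfold sign_label. destruct (Rlt_dec a 0); [reflexivity|lra]. Qed.

(* Along an edge where the first coordinate vanishes, the second one changes
   sign only at [i0]; whether this produces an edge [L1]-[L2] depends on the
   sign of the third coordinate there. *)
Lemma row_parity n i0 (f g : nat -> R) :
  (0 < i0 <= n)%nat ->
  (forall i, (i < i0)%nat -> f i < 0) -> (forall i, (i0 <= i)%nat -> 0 <= f i) ->
  xsum n (fun i => edge12 (sign_label 0 (f i) (g i)) (sign_label 0 (f (S i)) (g (S i))))
  = if Rlt_dec (g i0) 0 then true else false.
Proof.
  intros Hi Hlt Hge. rewrite (xsum_single n _ (pred i0)); [|lia|].
  - replace (S (pred i0)) with i0 by lia.
    assert (H1 := Hlt (pred i0) ltac:(lia)). assert (H2 := Hge i0 ltac:(lia)).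
    unfold sign_label.
    destruct (Rlt_dec 0 0); [lra|]. destruct (Rlt_dec (f (pred i0)) 0); [|lra].
    destruct (Rlt_dec (f i0) 0); [lra|]. now destruct (Rlt_dec (g i0) 0).
  - intros i Hi1 Hi2. unfold sign_label. destruct (Rlt_dec 0 0); [lra|].
    destruct (Nat.lt_ge_cases i i0) as [Hc|Hc].
    + assert (H1 := Hlt i Hc). assert (H2 := Hlt (S i) ltac:(lia)).
      destruct (Rlt_dec (f i) 0); [|lra]. destruct (Rlt_dec (f (S i)) 0); [|lra]. reflexivity.
    + assert (H1 := Hge i Hc). assert (H2 := Hge (S i) ltac:(lia)).
      destruct (Rlt_dec (f i) 0); [lra|]. destruct (Rlt_dec (f (S i)) 0); [lra|].
      now destruct (Rlt_dec (g i) 0), (Rlt_dec (g (S i)) 0).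
Qed.

Lemma square012_no0 a b c d :
  a <> L0 -> b <> L0 -> c <> L0 -> d <> L0 -> square012 a b c d = false.
Proof. intros; destruct a, b, c, d; try reflexivity; congruence. Qed.

Lemma square012_no2 a b c d :
  a <> L2 -> b <> L2 -> c <> L2 -> d <> L2 -> square012 a b c d = false.
Proof. intros; destruct a, b, c, d; try reflexivity; congruence. Qed.

Lemma locally_same_sign (G : R * (R * R) -> R) (t : R * (R * R)) :
  continuous G t -> G t <> 0 ->
  exists d : posreal, forall x, Rabs (fst x - fst t) < d ->
    Rabs (fst (snd x) - fst (snd t)) < d -> Rabs (snd (snd x) - snd (snd t)) < d ->
    0 < G x * G t.
Proof.
  intros HG Hn.
  assert (Hp : 0 < Rabs (G t)) by now apply Rabs_pos_lt.
  destruct (proj1 (filterlim_locally G (G t)) HG (mkposreal _ Hp)) as [d Hd].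
  exists d. intros x H1 H2 H3.
  assert (H := Hd x (conj H1 (conj H2 H3))).
  unfold ball in H; simpl in H. unfold AbsRing_ball, abs, minus, plus, opp in H; simpl in H.
  assert (H4 : 0 < Rabs (G t) * Rabs (G t)) by nra.
  unfold Rabs in *. repeat destruct Rcase_abs; nra.
Qed.

Lemma no_zero_uniform_label (G1 G2 G3 : R * (R * R) -> R) (a b a' b' : R) :
  (forall x, continuous G1 x) -> (forall x, continuous G2 x) -> (forall x, continuous G3 x) ->
  (forall s t1 t2, a <= s <= b -> a' <= t1 <= b' -> a' <= t2 <= b' ->
     G1 (s, (t1, t2)) = 0 -> G2 (s, (t1, t2)) = 0 -> G3 (s, (t1, t2)) = 0 -> False) ->
  exists d : posreal, forall s t1 t2, a <= s <= b -> a' <= t1 <= b' -> a' <= t2 <= b' ->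
    exists l, forall s' t1' t2', Rabs (s' - s) < d -> Rabs (t1' - t1) < d ->
      Rabs (t2' - t2) < d ->
      l <> sign_label (G1 (s', (t1', t2'))) (G2 (s', (t1', t2'))) (G3 (s', (t1', t2'))).
Proof.
  intros C1 C2 C3 Hno.
  (* The factor 2 leaves one radius to reach the given point from the centre of a covering box, and
     another to reach its neighbours. *)
  pose (P := fun (t : R * (R * (R * unit))) (d : posreal) =>
    exists l, forall s' t1' t2', Rabs (s' - fst t) < 2 * d ->
      Rabs (t1' - fst (snd t)) < 2 * d -> Rabs (t2' - fst (snd (snd t))) < 2 * d ->
      l <> sign_label (G1 (s', (t1', t2'))) (G2 (s', (t1', t2'))) (G3 (s', (t1', t2')))).
  assert (HP : forall t, exists d : posreal,
     bounded_n 3 (a, (a', (a', tt))) (b, (b', (b', tt))) t -> P t d).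
  { intros (s & t1 & t2 & []).
    destruct (classic (a <= s <= b /\ a' <= t1 <= b' /\ a' <= t2 <= b')) as [Hin|Hout].
    2:{ exists (mkposreal 1 Rlt_0_1). intros Hb. exfalso. apply Hout.
        simpl in Hb. tauto. }
    assert (Half : forall (G : R * (R * R) -> R),
      continuous G (s, (t1, t2)) -> G (s, (t1, t2)) <> 0 ->
      exists d : posreal, forall s' t1' t2', Rabs (s' - s) < 2 * d ->
        Rabs (t1' - t1) < 2 * d -> Rabs (t2' - t2) < 2 * d ->
        0 < G (s', (t1', t2')) * G (s, (t1, t2))).
    { intros G HG Hn. destruct (locally_same_sign G _ HG Hn) as [d Hd].
      exists (pos_div_2 d). intros s' t1' t2' H1 H2 H3. simpl in H1, H2, H3.
      apply Hd; simpl; lra. }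
    destruct (Req_dec (G1 (s, (t1, t2))) 0) as [E1|N1].
    1: destruct (Req_dec (G2 (s, (t1, t2))) 0) as [E2|N2].
    1: destruct (Req_dec (G3 (s, (t1, t2))) 0) as [E3|N3].
    - exfalso. apply (Hno s t1 t2); tauto.
    - destruct (Half G3 (C3 _) N3) as [d Hd]. exists d. intros _.
      exists (if Rlt_dec (G3 (s, (t1, t2))) 0 then L3 else L2).
      intros s' t1' t2' H1 H2 H3. specialize (Hd s' t1' t2' H1 H2 H3).
      unfold sign_label. repeat destruct Rlt_dec; try discriminate; nra.
    - destruct (Half G2 (C2 _) N2) as [d Hd]. exists d. intros _.
      exists (if Rlt_dec (G2 (s, (t1, t2))) 0 then L2 else L1).
      intros s' t1' t2' H1 H2 H3. specialize (Hd s' t1' t2' H1 H2 H3).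
      unfold sign_label. repeat destruct Rlt_dec; try discriminate; nra.
    - destruct (Half G1 (C1 _) N1) as [d Hd]. exists d. intros _.
      exists (if Rlt_dec (G1 (s, (t1, t2))) 0 then L1 else L0).
      intros s' t1' t2' H1 H2 H3. specialize (Hd s' t1' t2' H1 H2 H3).
      unfold sign_label. repeat destruct Rlt_dec; try discriminate; nra. }
  pose (delta := fun t => proj1_sig (constructive_indefinite_description _ (HP t))).
  assert (Hdelta : forall t, bounded_n 3 (a, (a', (a', tt))) (b, (b', (b', tt))) t ->
     P t (delta t)).
  { intros t. exact (proj2_sig (constructive_indefinite_description _ (HP t))). }
  destruct (compactness_value 3 (a, (a', (a', tt))) (b, (b', (b', tt))) delta) as [d Hd].
  exists d. intros s t1 t2 Hs Ht1 Ht2.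
  specialize (Hd (s, (t1, (t2, tt)))). simpl in Hd.
  apply NNPP in Hd; [|tauto].
  destruct Hd as ((s0 & u1 & u2 & []) & Hb & (A1 & A2 & A3 & _) & Hle).
  destruct (Hdelta (s0, (u1, (u2, tt))) Hb) as [l Hl]. exists l. simpl in Hl, Hle.
  intros s' t1' t2' B1 B2 B3.
  apply Hl; [replace (s' - s0) with ((s' - s) + (s - s0)) by ring
    |replace (t1' - u1) with ((t1' - t1) + (t1 - u1)) by ring
    |replace (t2' - u2) with ((t2' - t2) + (t2 - u2)) by ring];
  (eapply Rle_lt_trans; [apply Rabs_triang|]); lra.
Qed.

(** * Crossing of two level lines *)

Lemma continuous_comp2 {T : UniformSpace} (h : R -> R -> R) (f g : T -> R) (x : T) :
  (forall p, continuous (fun p : R * R => h (fst p) (snd p)) p) ->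
  continuous f x -> continuous g x -> continuous (fun y => h (f y) (g y)) x.
Proof. intros H Hf Hg. apply continuous_comp_2; auto. Qed.

Lemma continuous_Rminus {T : UniformSpace} (f g : T -> R) (x : T) :
  continuous f x -> continuous g x -> continuous (fun y => f y - g y) x.
Proof. intros. now apply (continuous_minus (K := R_AbsRing) (V := R_NormedModule)). Qed.

(** The required triple is a common zero of [G1], [G2], [G3] on a box. Without one, every cell of a
    fine grid misses a label and the outer faces carry an even number of complete triangles. The
    hypotheses at the ends make that number odd: the zeros of [u] and of [u - c] on the boundary
    lines alternate. *)
Lemma level_crossing (u L : R -> R -> R) (c : R) (M : nat) :
  (forall p, continuous (fun p : R * R => u (fst p) (snd p)) p) ->
  (forall p, continuous (fun p : R * R => L (fst p) (snd p)) p) ->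
  (1 <= M)%nat -> - / 2 < c < / 2 ->
  (forall s, u s (-1) = s) -> (forall s, u s 2 = s + / 2) ->
  (forall s, L s (-1) = -1) -> (forall s, L s 2 = -1) ->
  (forall s t, -1 < t < 2 -> -1 < L s t) ->
  (forall t, -1 <= t <= 2 -> 0 <= u (INR M) t /\ c <= u (INR M) t) ->
  (forall t, -1 <= t <= 2 -> u (- INR M) t < 0) ->
  exists s t1 t2, - INR M <= s <= INR M /\ -1 <= t1 <= 2 /\ -1 <= t2 <= 2 /\
    u s t1 = 0 /\ u s t2 = c /\ L s t1 = L s t2.
Proof.
  intros Cu CL HM Hc Hu0 Hu1 HL0 HL1 HLi Hr Hl.
  apply NNPP; intros Hno.
  pose (G1 := fun p : R * (R * R) => L (fst p) (fst (snd p)) - L (fst p) (snd (snd p))).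
  pose (G2 := fun p : R * (R * R) => u (fst p) (fst (snd p))).
  pose (G3 := fun p : R * (R * R) => u (fst p) (snd (snd p)) - c).
  assert (K0 : forall x : R * (R * R), continuous (fun p : R * (R * R) => fst p) x)
    by (intros [x y]; apply continuous_fst).
  assert (K1 : forall x : R * (R * R), continuous (fun p : R * (R * R) => fst (snd p)) x)
    by (intros [x [y z]]; apply (continuous_comp snd fst);
        [apply continuous_snd|apply continuous_fst]).
  assert (K2 : forall x : R * (R * R), continuous (fun p : R * (R * R) => snd (snd p)) x)
    by (intros [x [y z]]; apply (continuous_comp snd snd);
        [apply continuous_snd|apply continuous_snd]).
  assert (C1 : forall x, continuous G1 x)
    by (intros x; apply continuous_Rminus; apply continuous_comp2; auto).
  assert (C2 : forall x, continuous G2 x) by (intros x; apply continuous_comp2; auto).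
  assert (C3 : forall x, continuous G3 x)
    by (intros x; apply continuous_Rminus; [apply continuous_comp2; auto|apply continuous_const]).
  destruct (no_zero_uniform_label G1 G2 G3 (- INR M) (INR M) (-1) 2 C1 C2 C3) as [d Hd].
  { intros s t1 t2 Hs Ht1 Ht2 E1 E2 E3. apply Hno. exists s, t1, t2.
    unfold G1, G2, G3 in *; simpl in *. repeat split; lra. }
  destruct (nfloor_ex (3 / d)) as [q [_ Hq]].
  { apply Rlt_le, Rdiv_lt_0_compat; [lra|apply cond_pos]. }
  (* With steps 1 / (2 Q) in [s], both 0 and -1/2 are grid points, where [u] vanishes on the lines
     [t = -1] and [t = 2]. As [N] is at least 2, the first and last squares across a face are
     distinct. *)
  set (Q := S q). set (N := S (S q)).
  assert (HQ : 0 < INR Q) by (apply lt_0_INR; unfold Q; lia).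
  assert (HN : INR N = INR Q + 1) by (unfold N; now rewrite S_INR).
  assert (Hq' : 3 < d * INR Q).
  { unfold Q. rewrite S_INR. replace 3 with (d * (3 / d)) by (field; apply Rgt_not_eq, cond_pos).
    apply Rmult_lt_compat_l; [apply cond_pos|lra]. }
  assert (HM' : 1 <= INR M) by (change 1 with (INR 1); now apply le_INR).
  pose (s_ := fun i : nat => - INR M + INR i / (2 * INR Q)).
  pose (t_ := fun j : nat => -1 + 3 * INR j / INR N).
  assert (dpos := cond_pos d).
  assert (Es : forall i, s_ (S i) - s_ i = / (2 * INR Q)).
  { intros i. unfold s_. rewrite S_INR. field. lra. }
  assert (Et : forall i, t_ (S i) - t_ i = 3 / INR N).
  { intros i. unfold t_. rewrite S_INR. field. lra. }
  assert (Hs1 : 0 < / (2 * INR Q) < d).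
  { split; [apply Rinv_0_lt_compat; lra|].
    apply (Rmult_lt_reg_r (2 * INR Q)); [lra|]. rewrite Rinv_l by lra. lra. }
  assert (Ht1 : 0 < 3 / INR N < d).
  { split; [apply Rdiv_lt_0_compat; lra|].
    apply (Rmult_lt_reg_r (INR N)); [lra|]. unfold Rdiv. rewrite Rmult_assoc, Rinv_l by lra. rewrite HN. lra. }
  assert (Ms : forall i k, (i <= k)%nat -> s_ i <= s_ k).
  { intros i k Hik. apply le_INR in Hik. unfold s_, Rdiv. nra. }
  assert (Mt : forall i k, (i <= k)%nat -> t_ i <= t_ k).
  { intros i k Hik. apply le_INR in Hik. unfold t_, Rdiv in *.
    assert (0 < / INR N) by (apply Rinv_0_lt_compat; lra). nra. }
  assert (Mt' : forall i k, (i < k)%nat -> t_ i < t_ k).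
  { intros i k Hik. assert (H := Mt (S i) k Hik). assert (E := Et i). destruct Ht1 as [Ht1 _]. rewrite <- E in Ht1. lra. }
  assert (I2 : INR 2 = 2) by (simpl; ring).
  assert (I4 : INR 4 = 4) by (simpl; ring).
  assert (s0 : s_ O = - INR M) by (unfold s_; rewrite INR_0; field; lra).
  assert (sn : s_ (4 * M * Q)%nat = INR M).
  { unfold s_. rewrite !mult_INR, ?I2, ?I4. field. lra. }
  assert (sm : s_ (2 * M * Q)%nat = 0).
  { unfold s_. rewrite !mult_INR, ?I2, ?I4. field. lra. }
  assert (LeQ : (Q <= 2 * M * Q)%nat) by nia.
  assert (sh : s_ (2 * M * Q - Q)%nat = - / 2).
  { unfold s_. rewrite minus_INR, !mult_INR, I2 by exact LeQ. field. lra. }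
  assert (t0 : t_ O = -1) by (unfold t_; rewrite INR_0; field; lra).
  assert (tn : t_ N = 2) by (unfold t_; field; lra).
  pose (lab := fun i j k => sign_label (G1 (s_ i, (t_ j, t_ k)))
                 (G2 (s_ i, (t_ j, t_ k))) (G3 (s_ i, (t_ j, t_ k)))).
  assert (HP := grid_parity (4 * M * Q) N N lab).
  assert (Rg : forall j, (j <= N)%nat -> -1 <= t_ j <= 2).
  { intros j Hj. rewrite <- t0, <- tn. split; apply Mt; lia. }
  (* The cells give boundary parity [false]; evaluating the faces will give [true]. *)
  cut (false = true); [discriminate|].
  rewrite <- HP; clear HP.
  2:{ intros i j k Hi Hj Hk.
    destruct (Hd (s_ i) (t_ j) (t_ k)) as [l Hl'].
    - assert (B1 := Ms O i ltac:(lia)). assert (B2 := Ms i (4 * M * Q)%nat ltac:(lia)). lra.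
    - apply Rg; lia.
    - apply Rg; lia.
    - exists l. intros i' j' k' Hi' Hj' Hk'. apply Hl'.
      + assert (Ci : i' = i \/ i' = S i) by lia. specialize (Es i).
        destruct Ci as [-> | ->]; apply Rabs_def1; lra.
      + assert (Ci : j' = j \/ j' = S j) by lia. specialize (Et j).
        destruct Ci as [-> | ->]; apply Rabs_def1; lra.
      + assert (Ci : k' = k \/ k' = S k) by lia. specialize (Et k).
        destruct Ci as [-> | ->]; apply Rabs_def1; lra. }
  cbv zeta.
  (* Faces [s = INR M] and [s = - INR M]: on the first, [G2] and [G3] are nonnegative; on the
     second, [G2] is negative. In both cases [L2] is absent. *)
  rewrite (xsum_false N).
  2:{ intros j Hj. apply xsum_false; intros k Hk.
    assert (A : forall j k, (j <= N)%nat -> (k <= N)%nat ->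
      lab O j k <> L2 /\ lab (4 * M * Q)%nat j k <> L2).
    { clear j k Hj Hk. intros j k Hj Hk. unfold lab, G2, G3. cbn [fst snd].
      rewrite sn, s0.
      assert (B1 := Hr (t_ j) (Rg _ Hj)). assert (B2 := Hl (t_ j) (Rg _ Hj)).
      assert (B3 := Hr (t_ k) (Rg _ Hk)).
      unfold sign_label. split; repeat destruct Rlt_dec; try discriminate; lra. }
    rewrite !square012_no2; [reflexivity|apply A; lia ..]. }
  (* Faces where [t2] is an end: there [L] takes its minimum -1, so [G1] is nonnegative and [L0] is
     absent. *)
  rewrite (xsum_false _ (fun i => xsum N (fun j => xorb (square012 (lab i j O) _ _ _) _))).
  2:{ intros i Hi. apply xsum_false; intros j Hj.
    assert (A : forall i j, (j <= N)%nat -> lab i j O <> L0 /\ lab i j N <> L0).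
    { clear i j Hi Hj. intros i j Hj. unfold lab, G1. cbn [fst snd].
      rewrite t0, tn, HL0, HL1.
      assert (B : -1 <= L (s_ i) (t_ j)).
      { destruct (Nat.eq_dec j O) as [->|]; [rewrite t0, HL0; lra|].
        destruct (Nat.eq_dec j N) as [->|]; [rewrite tn, HL1; lra|].
        apply Rlt_le, HLi. rewrite <- t0, <- tn. split; apply Mt'; lia. }
      unfold sign_label. split; repeat destruct Rlt_dec; try discriminate; lra. }
    rewrite !square012_no0; [reflexivity|apply A; lia ..]. }
  rewrite xorb_false_l, xorb_false_r.
  (* Faces where [t1] is an end: now [G1] is negative as soon as [t2] is not an end, so complete
     triangles can occur only in the squares along the four edges parallel to the [s] axis. *)
  assert (In0 : forall i k, (0 < k < N)%nat -> lab i O k = L0 /\ lab i N k = L0).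
  { intros i k Hk. unfold lab, G1. cbn [fst snd]. rewrite t0, tn, HL0, HL1.
    assert (B : -1 < L (s_ i) (t_ k)).
    { apply HLi. rewrite <- t0, <- tn. split; apply Mt'; lia. }
    split; apply sign_label_0; lra. }
  assert (Sq0 : forall a b, square012 a b L0 L0 = edge12 a b)
    by (intros [] []; reflexivity).
  assert (Sq1 : forall a b, square012 L0 L0 a b = edge12 a b)
    by (intros [] []; reflexivity).
  pose (e := fun j k i => edge12 (lab i j k) (lab (S i) j k)).
  (* In such a square the two vertices off the edge are labelled [L0], so its parity is that of an
     [L1]-[L2] pair on the edge itself. *)
  rewrite (xsum_ext _ _ (fun i => xorb (xorb (e O O i) (e N O i)) (xorb (e O N i) (e N N i)))).
  2:{ intros i Hi. unfold N at 1. rewrite xsum_ends.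
    - fold N. change (S q) with Q. change (S Q) with N.
      assert (Z : forall i', lab i' O 1%nat = L0 /\ lab i' N 1%nat = L0 /\
        lab i' O Q = L0 /\ lab i' N Q = L0).
      { intros i'. split; [|split; [|split]]; apply In0; unfold N, Q; lia. }
      destruct (Z i) as (-> & -> & -> & ->). destruct (Z (S i)) as (-> & -> & -> & ->).
      f_equal; f_equal; (apply Sq0 || apply Sq1).
    - intros k Hk. fold N.
      assert (Z : forall i', lab i' O k = L0 /\ lab i' N k = L0 /\
        lab i' O (S k) = L0 /\ lab i' N (S k) = L0).
      { intros i'. split; [|split; [|split]]; apply In0; unfold N; lia. }
      destruct (Z i) as (-> & -> & -> & ->). destruct (Z (S i)) as (-> & -> & -> & ->).
      reflexivity. }
  rewrite !xsum_xorb.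
  assert (Row : forall j k i0 h, (j = O \/ j = N) -> (k = O \/ k = N) ->
     (0 < i0 <= 4 * M * Q)%nat -> s_ i0 + h = 0 -> (forall s, u s (t_ j) = s + h) ->
     xsum (4 * M * Q) (e j k) =
       if Rlt_dec (u (s_ i0) (t_ k) - c) 0 then true else false).
  { intros j k i0 h Hj Hk Hi0 Hs0 Hu.
    rewrite <- (row_parity (4 * M * Q) i0 (fun i => u (s_ i) (t_ j))
                 (fun i => u (s_ i) (t_ k) - c) Hi0).
    - apply xsum_ext; intros i Hi. unfold e, lab, G1, G2, G3. cbn [fst snd].
      assert (B : forall s, L s (t_ j) - L s (t_ k) = 0).
      { intros s. destruct Hj as [-> | ->], Hk as [-> | ->]; rewrite ?t0, ?tn, ?HL0, ?HL1; ring. }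
      rewrite !B. reflexivity.
    - intros i Hi. rewrite Hu. assert (B := Ms (S i) i0 Hi). specialize (Es i). lra.
    - intros i Hi. rewrite Hu. assert (B := Ms i0 i Hi). lra. }
  rewrite (Row O O (2 * M * Q)%nat 0), (Row N O (2 * M * Q - Q)%nat (/ 2)),
    (Row O N (2 * M * Q)%nat 0), (Row N N (2 * M * Q - Q)%nat (/ 2));
    try (now auto); try (unfold Q; nia); try lra;
    try (intros s; rewrite ?t0, ?tn, ?Hu0, ?Hu1; ring).
  (* The four tests are -c < 0, -1/2 - c < 0, 1/2 - c < 0 and -c < 0. The outer two cancel, the
     second holds and the third fails: an odd total. *)
  rewrite sm, sh, t0, tn, !Hu0, !Hu1.
  repeat destruct Rlt_dec; try reflexivity; exfalso; lra.
Qed.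

(** * Continuous choice of an angle *)

(** Cross product over dot product is the tangent of the oriented angle from v to w. Since the dot
    product is positive, this angle is acute and [atan] recovers it, continuously in both
    vectors. *)
Lemma angle_step vx vy wx wy r th :
  0 < r -> vx = r * cos th -> vy = r * sin th -> 0 < vx * wx + vy * wy ->
  exists r', 0 < r' /\
    wx = r' * cos (th + atan ((vx * wy - vy * wx) / (vx * wx + vy * wy))) /\
    wy = r' * sin (th + atan ((vx * wy - vy * wx) / (vx * wx + vy * wy))).
Proof.
  intros Hr Ex Ey Hd.
  set (d := vx * wx + vy * wy) in *. set (x := vx * wy - vy * wx).
  set (a := atan (x / d)).
  assert (Ca : 0 < cos a) by (assert (B := atan_bound (x / d)); apply cos_gt_0; unfold a; lra).
  assert (Sa : sin a = x / d * cos a).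
  { assert (T : tan a = x / d) by apply tan_atan. rewrite <- T. unfold tan. field. lra. }
  assert (U := sin2_cos2 th). unfold Rsqr in U.
  (* The dot product is r |w| cos a, so this is the length of w. *)
  exists (d / (r * cos a)). split; [apply Rdiv_lt_0_compat; nra|].
  rewrite cos_plus, sin_plus, Sa.
  assert (E1 : r * wx = cos th * d - sin th * x).
  { unfold d, x. rewrite Ex, Ey.
    replace (r * wx) with (r * wx * (sin th * sin th + cos th * cos th)) by (rewrite U; ring).
    ring. }
  assert (E2 : r * wy = sin th * d + cos th * x).
  { unfold d, x. rewrite Ex, Ey.
    replace (r * wy) with (r * wy * (sin th * sin th + cos th * cos th)) by (rewrite U; ring).
    ring. }
  split; apply (Rmult_eq_reg_l r); try lra; [rewrite E1|rewrite E2]; field; lra.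
Qed.

(** With S = |a| + |b|, the dot product is at least S^2 / 2 - 2 e S - 2 e^2, which is positive for e
    = S / 8. *)
Lemma dot_pos_near a b p q p' q' e :
  0 < Rabs a + Rabs b -> e = (Rabs a + Rabs b) / 8 ->
  Rabs (p - a) < e -> Rabs (q - b) < e -> Rabs (p' - a) < e -> Rabs (q' - b) < e ->
  0 < p * p' + q * q'.
Proof.
  assert (K : forall a p p' e, Rabs (p - a) < e -> Rabs (p' - a) < e ->
    a * a - 2 * (Rabs a * e) - e * e <= p * p').
  { clear. intros a p p' e H1 H2. apply Rabs_def2 in H1, H2.
    unfold Rabs. destruct Rcase_abs; nra. }
  intros HS He H1 H2 H3 H4.
  assert (K1 := K a p p' e H1 H3). assert (K2 := K b q q' e H2 H4).
  assert (A1 : Rabs a * Rabs a = a * a) by (rewrite <- Rabs_mult; apply Rabs_pos_eq; nra).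
  assert (A2 : Rabs b * Rabs b = b * b) by (rewrite <- Rabs_mult; apply Rabs_pos_eq; nra).
  assert (A3 : 0 < (Rabs a + Rabs b) * (Rabs a + Rabs b)) by nra.
  subst e. nra.
Qed.

Lemma uniform_dot_pos (wx wy : R -> R -> R) (a b a' b' : R) :
  (forall p, continuous (fun p : R * R => wx (fst p) (snd p)) p) ->
  (forall p, continuous (fun p : R * R => wy (fst p) (snd p)) p) ->
  (forall s t, a <= s <= b -> a' <= t <= b' -> wx s t <> 0 \/ wy s t <> 0) ->
  exists d : posreal, forall s t s' t', a <= s <= b -> a' <= t <= b' ->
    Rabs (s' - s) < d -> Rabs (t' - t) < d ->
    0 < wx s t * wx s' t' + wy s t * wy s' t'.
Proof.
  intros Cx Cy Hn.
  pose (P := fun (x y : R) (d : posreal) => forall s t s' t',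
    Rabs (s - x) < 2 * d -> Rabs (t - y) < 2 * d ->
    Rabs (s' - x) < 2 * d -> Rabs (t' - y) < 2 * d ->
    0 < wx s t * wx s' t' + wy s t * wy s' t').
  assert (HP : forall x y, exists d : posreal, a <= x <= b -> a' <= y <= b' -> P x y d).
  { intros x y.
    destruct (classic (a <= x <= b /\ a' <= y <= b')) as [[Hx Hy]|Hout].
    2:{ exists (mkposreal 1 Rlt_0_1). tauto. }
    assert (HS : 0 < (Rabs (wx x y) + Rabs (wy x y)) / 8).
    { assert (A1 := Rabs_pos (wx x y)). assert (A2 := Rabs_pos (wy x y)).
      destruct (Hn x y Hx Hy) as [H|H]; apply Rabs_pos_lt in H; lra. }
    destruct (proj1 (filterlim_locally _ _) (Cx (x, y)) (mkposreal _ HS)) as [d1 H1].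
    destruct (proj1 (filterlim_locally _ _) (Cy (x, y)) (mkposreal _ HS)) as [d2 H2].
    assert (Hm : 0 < Rmin d1 d2) by (apply Rmin_pos; apply cond_pos).
    exists (pos_div_2 (mkposreal _ Hm)). intros _ _ s t s' t' B1 B2 B3 B4.
    simpl in B1, B2, B3, B4.
    assert (M1 := Rmin_l d1 d2). assert (M2 := Rmin_r d1 d2).
    assert (near : forall (z w : R) (e : R), Rabs (z - w) < e -> ball w e z) by (intros; assumption).
    apply (dot_pos_near (wx x y) (wy x y) _ _ _ _ ((Rabs (wx x y) + Rabs (wy x y)) / 8));
      [lra|reflexivity| | | |].
    - apply (H1 (s, t)). split; apply near; cbn [fst snd]; lra.
    - apply (H2 (s, t)). split; apply near; cbn [fst snd]; lra.
    - apply (H1 (s', t')). split; apply near; cbn [fst snd]; lra.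
    - apply (H2 (s', t')). split; apply near; cbn [fst snd]; lra. }
  pose (delta := fun x y => proj1_sig (constructive_indefinite_description _ (HP x y))).
  assert (Hdelta : forall x y, a <= x <= b -> a' <= y <= b' -> P x y (delta x y)).
  { intros x y. exact (proj2_sig (constructive_indefinite_description _ (HP x y))). }
  destruct (compactness_value_2d a b a' b' delta) as [d Hd].
  exists d. intros s t s' t' Hs Ht H1 H2.
  specialize (Hd s t Hs Ht). apply NNPP in Hd.
  destruct Hd as (x & y & Hx & Hy & A1 & A2 & Hle).
  assert (A3 := Rabs_triang (s' - s) (s - x)). assert (A4 := Rabs_triang (t' - t) (t - y)).
  replace (s' - s + (s - x)) with (s' - x) in A3 by ring.
  replace (t' - t + (t - y)) with (t' - y) in A4 by ring.
  assert (dp := cond_pos (delta x y)).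
  apply (Hdelta x y Hx Hy); lra.
Qed.

(** * Clamping to an interval, and rules of continuity *)

Definition clamp (a b x : R) : R := Rmax a (Rmin b x).

Lemma clamp_bounds a b x : a <= b -> a <= clamp a b x <= b.
Proof. intros. unfold clamp, Rmax, Rmin. repeat destruct Rle_dec; lra. Qed.

Lemma clamp_id a b x : a <= x <= b -> clamp a b x = x.
Proof. intros. unfold clamp, Rmax, Rmin. repeat destruct Rle_dec; lra. Qed.

Section ContinuityRules.
Context {T : UniformSpace}.
Implicit Types f g : T -> R.

Lemma continuous_Rplus f g x :
  continuous f x -> continuous g x -> continuous (fun y => f y + g y) x.
Proof. intros. now apply (continuous_plus (K := R_AbsRing) (V := R_NormedModule)). Qed.

Lemma continuous_Rmult f g x :
  continuous f x -> continuous g x -> continuous (fun y => f y * g y) x.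
Proof. intros. now apply (continuous_mult (K := R_AbsRing)). Qed.

Lemma continuous_Rdiv f g x :
  continuous f x -> continuous g x -> g x <> 0 -> continuous (fun y => f y / g y) x.
Proof.
  intros Hf Hg Hn. apply continuous_Rmult; [assumption|].
  apply (continuous_comp g Rinv); [assumption|]. now apply continuous_Rinv.
Qed.

Lemma continuous_Rabs_fun f x : continuous f x -> continuous (fun y => Rabs (f y)) x.
Proof. intros Hf. apply (continuous_comp f Rabs); [assumption|]. apply continuous_Rabs. Qed.

Lemma continuous_Rmax f g x :
  continuous f x -> continuous g x -> continuous (fun y => Rmax (f y) (g y)) x.
Proof.
  intros Hf Hg.
  apply (continuous_ext (fun y => (f y + g y + Rabs (f y - g y)) / 2)).
  - intros y. unfold Rmax, Rabs. destruct Rle_dec, Rcase_abs; lra.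
  - apply continuous_Rmult; [|apply continuous_const].
    repeat apply continuous_Rplus; try assumption.
    now apply continuous_Rabs_fun, continuous_Rminus.
Qed.

Lemma continuous_Rmin f g x :
  continuous f x -> continuous g x -> continuous (fun y => Rmin (f y) (g y)) x.
Proof.
  intros Hf Hg.
  apply (continuous_ext (fun y => (f y + g y - Rabs (f y - g y)) / 2)).
  - intros y. unfold Rmin, Rabs. destruct Rle_dec, Rcase_abs; lra.
  - apply continuous_Rmult; [|apply continuous_const].
    apply continuous_Rminus; [now apply continuous_Rplus|].
    now apply continuous_Rabs_fun, continuous_Rminus.
Qed.

Lemma continuous_clamp a b f x : continuous f x -> continuous (fun y => clamp a b (f y)) x.
Proof.
  intros. apply continuous_Rmax; [apply continuous_const|].
  apply continuous_Rmin; [apply continuous_const|assumption].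
Qed.
End ContinuityRules.

Lemma continuous_fst' (p : R * R) : continuous (fun p : R * R => fst p) p.
Proof. destruct p. apply continuous_fst. Qed.

Lemma continuous_snd' (p : R * R) : continuous (fun p : R * R => snd p) p.
Proof. destruct p. apply continuous_snd. Qed.

Fixpoint rsum (n : nat) (f : nat -> R) : R :=
  match n with O => 0 | S m => rsum m f + f m end.

(** The point (s, t) is reached from the origin along a segment cut into [N] equal steps, so short
    that the vector turns by less than a right angle at each. The angle is [th0] plus the sum of the
    turns, a finite sum of continuous functions. *)
Lemma angle_lift (wx wy : R -> R -> R) (M th0 : R) :
  (forall p, continuous (fun p : R * R => wx (fst p) (snd p)) p) ->
  (forall p, continuous (fun p : R * R => wy (fst p) (snd p)) p) ->
  0 < M ->
  (forall s t, - M <= s <= M -> 0 <= t <= 1 -> wx s t <> 0 \/ wy s t <> 0) ->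
  (exists r, 0 < r /\ wx 0 0 = r * cos th0 /\ wy 0 0 = r * sin th0) ->
  exists th : R -> R -> R,
    (forall p, continuous (fun p : R * R => th (fst p) (snd p)) p) /\ th 0 0 = th0 /\
    forall s t, - M <= s <= M -> 0 <= t <= 1 ->
      exists r, 0 < r /\ wx s t = r * cos (th s t) /\ wy s t = r * sin (th s t).
Proof.
  intros Cx Cy HM Hn H0.
  destruct (uniform_dot_pos wx wy (- M) M 0 1 Cx Cy Hn) as [d Hd].
  assert (dpos := cond_pos d).
  destruct (nfloor_ex ((M + 1) / d)) as [q [_ Hq]].
  { apply Rlt_le, Rdiv_lt_0_compat; lra. }
  set (N := S q).
  assert (HN : 0 < INR N) by (apply lt_0_INR; unfold N; lia).
  assert (Hq' : (M + 1) / INR N < d).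
  { apply (Rmult_lt_reg_r (INR N)); [assumption|].
    unfold Rdiv. rewrite Rmult_assoc, Rinv_l by lra. unfold N. rewrite S_INR.
    replace ((M + 1) * 1) with (d * ((M + 1) / d)) by (field; lra).
    apply Rmult_lt_compat_l; lra. }
  (* These are the division points of the segment from the origin to the clamped point. Clamping
     keeps them in the rectangle, so that the angle is continuous on the whole plane. *)
  pose (x := fun (i : nat) (s : R) => INR i / INR N * clamp (- M) M s).
  pose (y := fun (i : nat) (t : R) => INR i / INR N * clamp 0 1 t).
  pose (cross := fun i s t => wx (x i s) (y i t) * wy (x (S i) s) (y (S i) t)
                            - wy (x i s) (y i t) * wx (x (S i) s) (y (S i) t)).
  pose (dot := fun i s t => wx (x i s) (y i t) * wx (x (S i) s) (y (S i) t)
                          + wy (x i s) (y i t) * wy (x (S i) s) (y (S i) t)).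
  assert (Hfrac : forall i, (i <= N)%nat -> 0 <= INR i / INR N <= 1).
  { intros i Hi. apply le_INR in Hi. assert (Hi0 := pos_INR i). split.
    - apply Rmult_le_pos; [assumption|]. apply Rlt_le, Rinv_0_lt_compat; assumption.
    - apply (Rmult_le_reg_r (INR N)); [assumption|].
      unfold Rdiv. rewrite Rmult_assoc, Rinv_l; lra. }
  assert (Hdot : forall i s t, (i < N)%nat -> 0 < dot i s t).
  { intros i s t Hi. assert (F1 := Hfrac i ltac:(lia)).
    assert (B1 := clamp_bounds (- M) M s ltac:(lra)).
    assert (B2 := clamp_bounds 0 1 t ltac:(lra)).
    assert (P : 0 < / INR N) by now apply Rinv_0_lt_compat.
    unfold Rdiv in Hq'.
    apply Hd; unfold x, y.
    - split; nra.
    - split; nra.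
    - replace (_ - _) with (/ INR N * clamp (- M) M s) by (rewrite S_INR; field; lra).
      apply Rabs_def1; nra.
    - replace (_ - _) with (/ INR N * clamp 0 1 t) by (rewrite S_INR; field; lra).
      apply Rabs_def1; nra. }
  pose (th := fun n s t => th0 + rsum n (fun i => atan (cross i s t / dot i s t))).
  assert (Hx : forall i (p : R * R), continuous (fun p : R * R => x i (fst p)) p).
  { intros i p. apply continuous_Rmult; [apply continuous_const|].
    apply continuous_clamp, continuous_fst'. }
  assert (Hy : forall i (p : R * R), continuous (fun p : R * R => y i (snd p)) p).
  { intros i p. apply continuous_Rmult; [apply continuous_const|].
    apply continuous_clamp, continuous_snd'. }
  exists (th N). split; [|split].
  - intros p. unfold th. apply continuous_Rplus; [apply continuous_const|].
    assert (K : forall n, (n <= N)%nat -> continuous (fun p : R * R =>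
        rsum n (fun i => atan (cross i (fst p) (snd p) / dot i (fst p) (snd p)))) p).
    { induction n as [|n IH]; intros Hle; simpl; [apply continuous_const|].
      apply continuous_Rplus; [apply IH; lia|].
      apply (continuous_comp (fun p : R * R => cross n (fst p) (snd p) / dot n (fst p) (snd p)) atan);
        [|apply continuous_atan].
      apply continuous_Rdiv.
      - apply continuous_Rminus; apply continuous_Rmult; apply continuous_comp2; auto.
      - apply continuous_Rplus; apply continuous_Rmult; apply continuous_comp2; auto.
      - apply Rgt_not_eq, Hdot. lia. }
    now apply K.
  - unfold th.
    assert (K : forall n, rsum n (fun i => atan (cross i 0 0 / dot i 0 0)) = 0).
    { induction n as [|n IH]; simpl; [reflexivity|]. rewrite IH.
      replace (cross n 0 0) with 0.
      - unfold Rdiv. rewrite Rmult_0_l, atan_0. ring.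
      - unfold cross, x, y. rewrite !clamp_id by lra. rewrite !Rmult_0_r. ring. }
    rewrite K. ring.
  - intros s t Hs Ht.
    assert (K : forall n, (n <= N)%nat -> exists r, 0 < r /\
       wx (x n s) (y n t) = r * cos (th n s t) /\ wy (x n s) (y n t) = r * sin (th n s t)).
    { induction n as [|n IH]; intros Hle.
      - unfold th, x, y. simpl. unfold Rdiv. rewrite !Rmult_0_l, Rplus_0_r. exact H0.
      - destruct (IH ltac:(lia)) as (r & Hr & E1 & E2).
        destruct (angle_step _ _ _ _ r (th n s t) Hr E1 E2 (Hdot n s t Hle)) as (r' & Hr' & E3 & E4).
        exists r'. unfold th. simpl. rewrite <- Rplus_assoc. auto. }
    destruct (K N (le_n N)) as (r & Hr & E1 & E2). exists r. split; [assumption|].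
    unfold x, y in E1, E2. rewrite !clamp_id in E1, E2 by assumption.
    replace (INR N / INR N) with 1 in E1, E2 by (field; lra).
    rewrite !Rmult_1_l in E1, E2. auto.
Qed.

Lemma exists_angle a b : a <> 0 \/ b <> 0 ->
  exists th r, 0 < r /\ a = r * cos th /\ b = r * sin th.
Proof.
  intros Hn.
  assert (Hp : 0 < a * a + b * b) by (destruct Hn; nra).
  set (r := sqrt (a * a + b * b)).
  assert (Hr : 0 < r) by now apply sqrt_lt_R0.
  assert (Hrr : r * r = a * a + b * b) by (apply sqrt_sqrt; lra).
  assert (Hx : -1 <= a / r <= 1).
  { split; apply (Rmult_le_reg_r r); try assumption;
      unfold Rdiv; rewrite ?Rmult_assoc, Rinv_l by lra; nra. }
  assert (Hs : sin (acos (a / r)) = Rabs b / r).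
  { rewrite sin_acos by assumption.
    replace (1 - (a / r)²) with ((Rabs b / r)²).
    - apply sqrt_Rsqr. apply Rmult_le_pos; [apply Rabs_pos|].
      apply Rlt_le, Rinv_0_lt_compat; assumption.
    - unfold Rsqr. replace (Rabs b / r * (Rabs b / r)) with (b * b / (r * r)).
      + rewrite Hrr. replace (a / r * (a / r)) with (a * a / (r * r)) by (field; lra).
        rewrite Hrr. field. lra.
      + replace (b * b) with (Rabs b * Rabs b); [field; lra|].
        rewrite <- Rabs_mult. apply Rabs_pos_eq. nra. }
  destruct (Rle_dec 0 b) as [Hb|Hb].
  - exists (acos (a / r)), r. rewrite cos_acos, Hs by assumption.
    rewrite Rabs_pos_eq by assumption. repeat split; try assumption; field; lra.
  - exists (- acos (a / r)), r. rewrite cos_neg, sin_neg, cos_acos, Hs by assumption.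
    rewrite Rabs_left by lra. repeat split; try assumption; field; lra.
Qed.

(* A continuous function whose values all represent the same point of the
   circle cannot jump. *)
Lemma same_angle_constant (f : R -> R) (a b : R) :
  (forall x, continuous f x) -> a <= b ->
  (forall x, a <= x <= b -> cos (f x) = cos (f a) /\ sin (f x) = sin (f a)) ->
  f b = f a.
Proof.
  intros Cf Hab H.
  assert (K : forall x, a <= x <= b -> cos (f x - f a) = 1).
  { intros x Hx. rewrite cos_minus. destruct (H x Hx) as [-> ->].
    rewrite <- (sin2_cos2 (f a)). unfold Rsqr. ring. }
  destruct (Req_dec (f b) (f a)) as [E|N]; [exact E|exfalso].
  (* If the values at the ends differed, [f] would take a value at distance [h] from [f a], where
     the cosine of the difference is below 1. *)
  pose (h := Rmin PI (Rabs (f b - f a))).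
  assert (Pp := PI_RGT_0).
  assert (Hh : 0 < h <= PI).
  { split; [apply Rmin_pos; [lra|apply Rabs_pos_lt; lra]|apply Rmin_l]. }
  assert (Hc : cos h < 1).
  { rewrite <- cos_0. apply cos_decreasing_1; lra. }
  assert (Hh2 : h <= Rabs (f b - f a)) by apply Rmin_r.
  destruct (Rle_dec (f a) (f b)) as [Hle|Hle].
  - rewrite Rabs_pos_eq in Hh2 by lra.
    destruct (IVT_gen_consistent f a b (f a + h) Cf) as (x & Hx & E).
    { rewrite Rmin_left, Rmax_right by lra. lra. }
    rewrite Rmin_left, Rmax_right in Hx by lra.
    specialize (K x Hx). rewrite E in K. replace (f a + h - f a) with h in K by ring. lra.
  - rewrite Rabs_left in Hh2 by lra.
    destruct (IVT_gen_consistent f a b (f a - h) Cf) as (x & Hx & E).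
    { rewrite Rmin_right, Rmax_left by lra. lra. }
    rewrite Rmin_left, Rmax_right in Hx by lra.
    specialize (K x Hx). rewrite E in K. replace (f a - h - f a) with (- h) in K by ring.
    rewrite cos_neg in K. lra.
Qed.

(** * Normalised chords of a closed curve *)

Definition diff_quotient (g d : R -> R) (s t : R) : R :=
  if Req_dec_T t 0 then d s else (g (s + t) - g s) / t.

(** At t = 0, every nearby value is [d c] for some c close to s, by the mean value theorem, and [d]
    is continuous. Elsewhere the function is locally an ordinary quotient. *)
Lemma diff_quotient_continuous (g d : R -> R) (p : R * R) :
  (forall t, derivable_pt_lim g t (d t)) -> continuity d ->
  continuous (fun p : R * R => diff_quotient g d (fst p) (snd p)) p.
Proof.
  intros Hd Cd. destruct p as [s t].
  assert (Cg : forall x, continuous g x).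
  { intros x. apply (ex_derive_continuous (V := R_NormedModule)). exists (d x). now apply is_derive_Reals. }
  destruct (Req_dec_T t 0) as [E|N].
  - apply filterlim_locally. intros e.
    assert (C := proj1 (filterlim_locally _ _) (proj1 (continuity_pt_filterlim d s) (Cd s)) e).
    destruct C as [h Hh].
    exists (pos_div_2 h). intros [s' t'] [B1 B2]. cbn [fst snd] in *.
    assert (B1' : Rabs (s' - s) < h / 2) by exact B1.
    assert (B2' : Rabs (t' - t) < h / 2) by exact B2.
    clear B1 B2. apply Rabs_def2 in B1', B2'.
    assert (hp := cond_pos h).
    replace (diff_quotient g d s t) with (d s)
      by (unfold diff_quotient; destruct (Req_dec_T t 0); [reflexivity|lra]).
    assert (K : exists c, Rabs (c - s) < h /\ diff_quotient g d s' t' = d c).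
    { unfold diff_quotient. destruct (Req_dec_T t' 0) as [E'|N'].
      - exists s'. split; [apply Rabs_def1; lra|reflexivity].
      - destruct (MVT_gen g s' (s' + t') d) as (c & Hc & Ec).
        + intros x _. now apply is_derive_Reals.
        + intros x _. apply derivable_continuous_pt. exists (d x). apply Hd.
        + exists c. split.
          * unfold Rmin, Rmax in Hc. apply Rabs_def1; destruct Rle_dec; lra.
          * rewrite Ec. field. assumption. }
    destruct K as (c & Hc & ->). apply Hh. exact Hc.
  - apply (continuous_ext_loc _ (fun p : R * R => (g (fst p + snd p) - g (fst p)) / snd p)).
    + assert (Ht : 0 < Rabs t) by now apply Rabs_pos_lt.
      exists (mkposreal _ Ht). intros [s' t'] [_ B]. cbn [fst snd] in *.
      assert (B' : Rabs (t' - t) < Rabs t) by exact B.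
      unfold diff_quotient. destruct (Req_dec_T t' 0) as [E'|]; [|reflexivity].
      rewrite E', Rminus_0_l, Rabs_Ropp in B'. lra.
    + apply continuous_Rdiv; [|apply continuous_snd'|exact N].
      apply continuous_Rminus; apply (continuous_comp _ g); try apply Cg.
      * apply continuous_Rplus; [apply continuous_fst'|apply continuous_snd'].
      * apply continuous_fst'.
Qed.

(* Equals [(g (s + t) - g s) / (t (1 - t))] for [0 < t < 1], and extends
   continuously to [t = 0] and [t = 1] by [g' s] and [- g' s]. *)
Definition chord (g d : R -> R) (s t : R) : R :=
  diff_quotient g d s t - diff_quotient g d s (t - 1).

Lemma chord_continuous (g d : R -> R) (p : R * R) :
  (forall t, derivable_pt_lim g t (d t)) -> continuity d ->
  continuous (fun p : R * R => chord g d (fst p) (snd p)) p.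
Proof.
  intros Hd Cd. apply continuous_Rminus; [now apply diff_quotient_continuous|].
  apply (continuous_comp2 (diff_quotient g d) fst (fun p => snd p - 1)).
  - intros. now apply diff_quotient_continuous.
  - apply continuous_fst'.
  - apply continuous_Rminus; [apply continuous_snd'|apply continuous_const].
Qed.

Section PeriodicChord.
Variables g d : R -> R.
Hypothesis Hper : forall t, g (t + 1) = g t.
Hypothesis Hd : forall t, derivable_pt_lim g t (d t).

Lemma derivative_periodic t : d (t + 1) = d t.
Proof.
  apply (uniqueness_limite g t); [|apply Hd].
  intros e He. destruct (Hd (t + 1) e He) as [h Hh]. exists h.
  intros x Hx Hx2. rewrite <- (Hper (t + x)), <- (Hper t).
  replace (t + x + 1) with (t + 1 + x) by ring. now apply Hh.
Qed.

Lemma periodic_minus1 t : g (t - 1) = g t.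
Proof. rewrite <- (Hper (t - 1)). f_equal. ring. Qed.

(** By periodicity both difference quotients have numerator g (s + t) - g s up to sign, and 1 / t +
    1 / (1 - t) = 1 / (t (1 - t)). The product form also covers t = 0 and t = 1. *)
Lemma chord_spec s t : t * (1 - t) * chord g d s t = g (s + t) - g s.
Proof.
  unfold chord, diff_quotient.
  destruct (Req_dec_T t 0) as [->|N0].
  { rewrite Rplus_0_r. ring. }
  destruct (Req_dec_T (t - 1) 0) as [E|N1].
  { replace t with 1 by lra. rewrite Hper. ring. }
  replace (s + (t - 1)) with (s + t - 1) by ring. rewrite periodic_minus1. field. lra.
Qed.

(** The chord starting at s + t with parameter length 1 - t ends at s + 1, the same point as s: it
    is the old chord run backwards, and t (1 - t) is unchanged. *)
Lemma chord_reverse s t : chord g d (s + t) (1 - t) = - chord g d s t.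
Proof.
  unfold chord, diff_quotient.
  replace (1 - t - 1) with (- t) by ring.
  replace (s + t + (1 - t)) with (s + 1) by ring. rewrite Hper.
  replace (s + t + - t) with s by ring.
  replace (s + (t - 1)) with (s + t - 1) by ring. rewrite periodic_minus1.
  destruct (Req_dec_T t 0) as [E|N0].
  - subst t. rewrite Rplus_0_r.
    repeat destruct Req_dec_T; try lra; rewrite ?Rplus_0_r; field; lra.
  - destruct (Req_dec_T (1 - t) 0) as [E1|N1].
    + assert (t = 1) by lra. subst t. rewrite derivative_periodic.
      repeat destruct Req_dec_T; try lra; rewrite ?Hper; field; lra.
    + repeat destruct Req_dec_T; try lra; field; lra.
Qed.

Lemma chord_0 s : chord g d s 0 = d s.
Proof.
  unfold chord, diff_quotient. repeat destruct Req_dec_T; try lra.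
  replace (s + (0 - 1)) with (s - 1) by ring. rewrite periodic_minus1. field; lra.
Qed.

Lemma chord_1 s : chord g d s 1 = - d s.
Proof.
  assert (H := chord_reverse s 1). replace (1 - 1) with 0 in H by ring.
  rewrite chord_0, derivative_periodic in H. lra.
Qed.

Lemma periodic_INR n t : g (t + INR n) = g t.
Proof.
  induction n as [|n IH]; [simpl; now rewrite Rplus_0_r|].
  rewrite S_INR, <- Rplus_assoc, Hper. exact IH.
Qed.

Lemma periodic_IZR n t : g (t + IZR n) = g t.
Proof.
  destruct (Z_le_dec 0 n) as [H|H].
  - rewrite <- (Z2Nat.id n) by assumption. rewrite <- INR_IZR_INZ. apply periodic_INR.
  - rewrite <- (periodic_INR (Z.to_nat (- n)) (t + IZR n)). f_equal.
    rewrite INR_IZR_INZ, Z2Nat.id, opp_IZR by lia. ring.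
Qed.
End PeriodicChord.

Lemma injective_modulo_period (g1 g2 : R -> R) (s t : R) :
  (forall t, g1 (t + 1) = g1 t) -> (forall t, g2 (t + 1) = g2 t) ->
  (forall s t, 0 <= s < 1 -> 0 <= t < 1 -> g1 s = g1 t -> g2 s = g2 t -> s = t) ->
  0 < t < 1 -> g1 (s + t) = g1 s -> g2 (s + t) = g2 s -> False.
Proof.
  intros P1 P2 Hinj Ht E1 E2.
  destruct (base_Int_part s) as [I1 I2].
  set (n := Int_part s) in *. set (s0 := s + IZR (- n)).
  assert (Hs0 : 0 <= s0 < 1) by (unfold s0; rewrite opp_IZR; lra).
  assert (A1 : g1 (s0 + t) = g1 s0).
  { unfold s0. replace (s + IZR (- n) + t) with (s + t + IZR (- n)) by ring.
    rewrite !periodic_IZR by assumption. exact E1. }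
  assert (A2 : g2 (s0 + t) = g2 s0).
  { unfold s0. replace (s + IZR (- n) + t) with (s + t + IZR (- n)) by ring.
    rewrite !periodic_IZR by assumption. exact E2. }
  destruct (Rlt_dec (s0 + t) 1) as [L|L].
  - assert (s0 + t = s0) by (apply Hinj; auto; lra). lra.
  - assert (s0 + t - 1 = s0); [|lra].
    apply Hinj; try lra; rewrite periodic_minus1; assumption.
Qed.

(** For 0 < t < 1 this is injectivity of the curve; at the two ends it is the nonvanishing of the
    velocity. *)
Lemma chord_nonzero (g1 g2 d1 d2 : R -> R) (s t : R) :
  (forall t, g1 (t + 1) = g1 t) -> (forall t, g2 (t + 1) = g2 t) ->
  (forall t, derivable_pt_lim g1 t (d1 t)) -> (forall t, derivable_pt_lim g2 t (d2 t)) ->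
  (forall t, d1 t <> 0 \/ d2 t <> 0) ->
  (forall s t, 0 <= s < 1 -> 0 <= t < 1 -> g1 s = g1 t -> g2 s = g2 t -> s = t) ->
  0 <= t <= 1 -> chord g1 d1 s t <> 0 \/ chord g2 d2 s t <> 0.
Proof.
  intros P1 P2 D1 D2 Hn Hinj Ht.
  destruct (Req_dec t 0) as [->|N0]; [rewrite !chord_0 by assumption; apply Hn|].
  destruct (Req_dec t 1) as [->|N1].
  { rewrite !chord_1 by assumption. destruct (Hn s); [left|right]; lra. }
  destruct (Req_dec (chord g1 d1 s t) 0) as [E1|]; [|tauto].
  destruct (Req_dec (chord g2 d2 s t) 0) as [E2|]; [|tauto].
  exfalso. assert (C1 := chord_spec g1 d1 P1 s t). assert (C2 := chord_spec g2 d2 P2 s t).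
  rewrite E1 in C1. rewrite E2 in C2.
  apply (injective_modulo_period g1 g2 s t); auto; lra.
Qed.

Lemma polar_unique r r' a b :
  0 < r -> 0 < r' -> r * cos a = r' * cos b -> r * sin a = r' * sin b ->
  cos a = cos b /\ sin a = sin b.
Proof.
  intros Hr Hr' E1 E2.
  assert (U1 := sin2_cos2 a). assert (U2 := sin2_cos2 b). unfold Rsqr in *.
  assert (E : r * r = r' * r').
  { replace (r * r) with (r * r * (sin a * sin a + cos a * cos a)) by (rewrite U1; ring).
    replace (r' * r') with (r' * r' * (sin b * sin b + cos b * cos b)) by (rewrite U2; ring).
    replace (r * r * (sin a * sin a + cos a * cos a))
      with ((r * sin a) * (r * sin a) + (r * cos a) * (r * cos a)) by ring.
    rewrite E1, E2. ring. }
  assert (r = r') by nra. subst r'.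
  split; apply (Rmult_eq_reg_l r); lra.
Qed.

Lemma polar_difference r r' a b :
  0 < r -> 0 < r' -> r * cos a = r' * cos b -> r * sin a = r' * sin b ->
  cos (a - b) = 1 /\ sin (a - b) = 0.
Proof.
  intros Hr Hr' E1 E2. destruct (polar_unique r r' a b Hr Hr' E1 E2) as [C S].
  rewrite cos_minus, sin_minus, C, S. split; [|ring].
  rewrite <- (sin2_cos2 b). unfold Rsqr. ring.
Qed.

Lemma polar_opposite r r' a b :
  0 < r -> 0 < r' -> r * cos a = - (r' * cos b) -> r * sin a = - (r' * sin b) ->
  cos (a - b) = -1 /\ sin (a - b) = 0.
Proof.
  intros Hr Hr' E1 E2.
  destruct (polar_difference r r' a (b + PI) Hr Hr') as [C S].
  - rewrite neg_cos. lra.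
  - rewrite neg_sin. lra.
  - replace (a - b) with (a - (b + PI) + PI) by ring.
    rewrite neg_cos, neg_sin, C, S. split; ring.
Qed.

(** This lower bound is all that is retained of the total turn [k] being an odd multiple of PI. *)
Lemma Rabs_ge_PI x : cos x = -1 -> PI <= Rabs x.
Proof.
  intros H. assert (Pp := PI_RGT_0).
  assert (Hc : cos (Rabs x) = -1).
  { unfold Rabs. destruct Rcase_abs; [rewrite cos_neg|]; exact H. }
  destruct (Rle_dec PI (Rabs x)) as [L|L]; [exact L|exfalso].
  assert (Hp := Rabs_pos x).
  assert (C := cos_decreasing_1 (Rabs x) PI Hp ltac:(lra) ltac:(lra) ltac:(lra) ltac:(lra)).
  rewrite cos_PI in C. lra.
Qed.

(** * Angles of chords *)

Section ChordAngle.
Variables wx wy : R -> R -> R.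
Hypothesis Cx : forall p, continuous (fun p : R * R => wx (fst p) (snd p)) p.
Hypothesis Cy : forall p, continuous (fun p : R * R => wy (fst p) (snd p)) p.
Hypothesis nonzero : forall s t, 0 <= t <= 1 -> wx s t <> 0 \/ wy s t <> 0.
Hypothesis revx : forall s t, wx (s + t) (1 - t) = - wx s t.
Hypothesis revy : forall s t, wy (s + t) (1 - t) = - wy s t.

(** The strip is bounded because [angle_lift] relies on compactness; wider strips need new angles,
    compared by [is_angle_unique]. *)
Definition is_angle (M : R) (th : R -> R -> R) : Prop :=
  (forall p, continuous (fun p : R * R => th (fst p) (snd p)) p) /\
  forall s t, - M <= s <= M -> 0 <= t <= 1 ->
    exists r, 0 < r /\ wx s t = r * cos (th s t) /\ wy s t = r * sin (th s t).

(* Reversing a chord turns it by a fixed odd multiple of [PI]; reversing it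
   twice shows that one turn along the curve contributes exactly twice that
   amount. This weak form of the Umlaufsatz is all that is needed. *)
Lemma angle_reverse M th :
  is_angle (M + 2) th -> 0 <= M ->
  let k := th 0 1 - th 0 0 in
  cos k = -1 /\
  (forall s t, - (M + 1) <= s <= M + 1 -> 0 <= t <= 1 ->
     th (s + t) (1 - t) = th s t + k) /\
  (forall s t, - M <= s <= M -> 0 <= t <= 1 -> th (s + 1) t = th s t + 2 * k).
Proof.
  intros [Ct Ht] HM k.
  assert (Opp : forall s t, - (M + 1) <= s <= M + 1 -> 0 <= t <= 1 ->
     cos (th (s + t) (1 - t) - th s t) = -1 /\ sin (th (s + t) (1 - t) - th s t) = 0).
  { intros s t Hs Hi.
    destruct (Ht s t ltac:(lra) Hi) as (r & Hr & E1 & E2).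
    destruct (Ht (s + t) (1 - t) ltac:(lra) ltac:(lra)) as (r' & Hr' & E3 & E4).
    rewrite revx, E1 in E3. rewrite revy, E2 in E4.
    apply (polar_opposite r' r); lra. }
  assert (Hk : cos k = -1 /\ sin k = 0).
  { assert (O := Opp 0 0 ltac:(lra) ltac:(lra)).
    rewrite Rplus_0_r, Rminus_0_r in O. exact O. }
  assert (R1 : forall s t, - (M + 1) <= s <= M + 1 -> 0 <= t <= 1 ->
     th (s + t) (1 - t) = th s t + k).
  { intros s t Hs Hi.
    (* The chord (s, t) is shrunk to (0, 0) along a segment while its reverse moves to (0, 1). The
       difference of their angles represents the same point of the circle throughout, hence stays
       equal to [k]. *)
    pose (f := fun x => th (x * (s + t)) (1 - x * t) - th (x * s) (x * t)).
    assert (E : f 1 = f 0).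
    { apply same_angle_constant; [|lra|].
      - intros x. apply continuous_Rminus; apply continuous_comp2; try apply Ct;
          repeat (apply continuous_Rminus || apply continuous_Rmult ||
                  apply continuous_const || apply continuous_id).
      - assert (E0 : f 0 = k).
        { unfold f, k. rewrite !Rmult_0_l, Rminus_0_r. reflexivity. }
        intros x Hx. rewrite E0. destruct Hk as [-> ->].
        unfold f. replace (x * (s + t)) with (x * s + x * t) by ring.
        apply Opp; [|nra].
        destruct (Rle_dec 0 s); nra. }
    unfold f in E. rewrite !Rmult_1_l, !Rmult_0_l, Rminus_0_r in E. unfold k. lra. }
  split; [apply Hk|]. split; [exact R1|].
  intros s t Hs Hi.
  assert (E1 := R1 s t ltac:(lra) Hi).
  assert (E2 := R1 (s + t) (1 - t) ltac:(lra) ltac:(lra)).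
  replace (s + t + (1 - t)) with (s + 1) in E2 by ring.
  replace (1 - (1 - t)) with t in E2 by ring. lra.
Qed.

Lemma angle_translate M th n :
  is_angle (M + 2) th -> INR n <= M ->
  forall t, 0 <= t <= 1 ->
    th (INR n) t = th 0 t + 2 * (th 0 1 - th 0 0) * INR n /\
    th (- INR n) t = th 0 t - 2 * (th 0 1 - th 0 0) * INR n.
Proof.
  intros HA HM t Ht.
  assert (H0 := pos_INR n).
  destruct (angle_reverse M th HA ltac:(lra)) as (_ & _ & R2).
  induction n as [|n IH].
  - simpl. rewrite Ropp_0. lra.
  - rewrite S_INR in *. assert (Hn := pos_INR n).
    destruct (IH ltac:(lra) Hn) as [I1 I2].
    assert (E1 := R2 (INR n) t ltac:(lra) Ht).
    assert (E2 := R2 (- (INR n + 1)) t ltac:(lra) Ht).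
    replace (- (INR n + 1) + 1) with (- INR n) in E2 by ring.
    split; lra.
Qed.

(** The difference of two angles is a multiple of 2 PI, hence constant along s = 0. *)
Lemma is_angle_unique M M' th th' t :
  is_angle M th -> is_angle M' th' -> 0 <= M -> 0 <= M' -> th 0 0 = th' 0 0 ->
  0 <= t <= 1 -> th 0 t = th' 0 t.
Proof.
  intros [C H] [C' H'] HM HM' E0 Ht.
  pose (f := fun x => th 0 x - th' 0 x).
  assert (E : f t = f 0).
  { apply same_angle_constant; [|lra|].
    - intros x. apply continuous_Rminus; apply continuous_comp2; auto;
        first [apply continuous_const|apply continuous_id].
    - intros x Hx. unfold f at 2 4. rewrite E0, Rminus_diag, cos_0, sin_0.
      destruct (H 0 x ltac:(lra) ltac:(lra)) as (r & Hr & E1 & E2).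
      destruct (H' 0 x ltac:(lra) ltac:(lra)) as (r' & Hr' & E3 & E4).
      apply (polar_difference r r'); try assumption; lra. }
  unfold f in E. lra.
Qed.

(* The bound [B] comes from one fixed angle, so that it does not depend on the
   width [M] of the strip on which the angle is defined. *)
Lemma wide_angle : exists (M : nat) (th : R -> R -> R),
  (1 <= M)%nat /\ is_angle (INR M + 2) th /\
  forall t, 0 <= t <= 1 -> Rabs (th 0 t) <= INR M - 1.
Proof.
  destruct (exists_angle (wx 0 0) (wy 0 0) (nonzero 0 0 ltac:(lra))) as (th0 & Hth0).
  assert (Ex : forall M, 0 < M -> exists th, is_angle M th /\ th 0 0 = th0).
  { intros M HM.
    destruct (angle_lift wx wy M th0 Cx Cy HM) as (th & C & E & H).
    - intros; now apply nonzero.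
    - exact Hth0.
    - exists th. repeat split; assumption. }
  destruct (Ex 1 Rlt_0_1) as (th1 & H1 & E1).
  destruct (continuity_ab_maj (fun t => Rabs (th1 0 t)) 0 1 ltac:(lra)) as (x & Hx & _).
  { intros t _. apply continuity_pt_filterlim. apply (continuous_Rabs_fun (fun t => th1 0 t)).
    apply continuous_comp2; [apply H1|apply continuous_const|apply continuous_id]. }
  destruct (nfloor_ex (Rabs (th1 0 x)) (Rabs_pos _)) as [n [_ Hn]].
  (* The fixed angle is below [INR n + 1] in absolute value, and this number is [INR M - 1]. *)
  exists (S (S n)).
  assert (Hp := pos_INR n).
  destruct (Ex (INR (S (S n)) + 2)) as (th & H & E); [rewrite !S_INR; lra|].
  exists th. split; [lia|]. split; [exact H|].
  intros t Ht.
  rewrite (is_angle_unique (INR (S (S n)) + 2) 1 th th1 t H H1); try lra;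
    [|rewrite !S_INR; lra].
  rewrite !S_INR. specialize (Hx t Ht). lra.
Qed.
End ChordAngle.

(** * Inscribed right isosceles triangles *)

Lemma inscribed_corner (g1 g2 : R -> R) :
  injective_C1_immersion_S1 g1 g2 ->
  exists s t1 t2 r, 0 < r /\
    g1 t1 = g1 s + r /\ g2 t1 = g2 s /\ g1 t2 = g1 s /\ g2 t2 = g2 s + r.
Proof.
  intros (Hper & (d1 & d2 & D1 & D2 & Cd1 & Cd2 & Hn) & Hinj).
  assert (P1 : forall t, g1 (t + 1) = g1 t) by (intros; apply Hper).
  assert (P2 : forall t, g2 (t + 1) = g2 t) by (intros; apply Hper).
  set (wx := chord g1 d1). set (wy := chord g2 d2).
  assert (Cx : forall p, continuous (fun p : R * R => wx (fst p) (snd p)) p)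
    by (intros; now apply chord_continuous).
  assert (Cy : forall p, continuous (fun p : R * R => wy (fst p) (snd p)) p)
    by (intros; now apply chord_continuous).
  assert (Nz : forall s t, 0 <= t <= 1 -> wx s t <> 0 \/ wy s t <> 0)
    by (intros; now apply chord_nonzero).
  assert (Rx : forall s t, wx (s + t) (1 - t) = - wx s t)
    by (intros; now apply chord_reverse).
  assert (Ry : forall s t, wy (s + t) (1 - t) = - wy s t)
    by (intros; now apply chord_reverse).
  destruct (wide_angle wx wy Cx Cy Nz) as (M & th & HM1 & HA & HB).
  assert (HM : 1 <= INR M) by (change 1 with (INR 1); now apply le_INR).
  destruct (angle_reverse wx wy Rx Ry (INR M) th HA ltac:(lra)) as (Hk & R1 & _).
  assert (Tr := angle_translate wx wy Rx Ry (INR M) th M HA (Rle_refl _)).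
  destruct HA as [Ct Ht].
  set (k := th 0 1 - th 0 0) in *.
  apply Rabs_ge_PI in Hk. assert (Pp := PI2_1).
  assert (Kn : k <> 0) by (intros E; rewrite E, Rabs_R0 in Hk; lra).
  (* The direction PI/2 corresponds to th / (2 k) = [c]. The bound |k| >= PI gives |c| <= 1/4,
     inside the range allowed by [level_crossing]. *)
  pose (c := PI / (4 * k)).
  assert (Hc : - / 4 <= c <= / 4 /\ c <> 0).
  { assert (Ec : c * k = PI / 4) by (unfold c; field; exact Kn).
    unfold Rabs in Hk. destruct Rcase_abs in Hk; repeat split; try nra;
      intros E; rewrite E in Ec; lra. }
  pose (cl := clamp 0 1).
  assert (Hcl : forall t, 0 <= cl t <= 1) by (intros; apply clamp_bounds; lra).
  (* [lam] is the distance from [t] to [0, 1], hence the depth in the collar. It serves both to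
     interpolate [u] towards s + [cl t] / 2 and to make the length negative. *)
  pose (lam := fun t => Rabs (t - cl t)).
  (* The sum norm agrees with the Euclidean length on horizontal and vertical chords, the only ones
     to be compared. *)
  pose (len := fun s t => Rabs (g1 (s + t) - g1 s) + Rabs (g2 (s + t) - g2 s)).
  pose (u := fun s t => (1 - lam t) * (th s (cl t) / (2 * k)) + lam t * (s + cl t / 2)).
  pose (L := fun s t => len s (cl t) - lam t).
  assert (Hlen : forall s t, 0 <= len s t).
  { intros. unfold len. apply Rplus_le_le_0_compat; apply Rabs_pos. }
  assert (Len0 : forall s, len s 0 = 0).
  { intros s. unfold len. rewrite Rplus_0_r, !Rminus_diag, Rabs_R0. ring. }
  assert (Len1 : forall s, len s 1 = 0).
  { intros s. unfold len. rewrite P1, P2, !Rminus_diag, Rabs_R0. ring. }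
  assert (Hlam : forall t, 0 <= lam t /\ (-1 <= t <= 2 -> lam t <= 1) /\
     (-1 < t < 2 -> lam t < 1)).
  { intros t. unfold lam, cl, clamp, Rmax, Rmin, Rabs.
    repeat destruct Rle_dec; destruct Rcase_abs; repeat split; intros; lra. }
  assert (Hin : forall t, 0 <= t <= 1 -> cl t = t /\ lam t = 0).
  { intros t Hi. unfold lam, cl. rewrite clamp_id by assumption.
    rewrite Rminus_diag, Rabs_R0. auto. }
  assert (Hout : forall t, cl t <> 0 -> cl t <> 1 -> lam t = 0).
  { intros t. unfold lam, cl, clamp, Rmax, Rmin.
    repeat destruct Rle_dec; intros; try lra; rewrite Rminus_diag; apply Rabs_R0. }
  assert (Cg1 : forall x, continuous g1 x).
  { intros x. apply (ex_derive_continuous (V := R_NormedModule)). exists (d1 x). now apply is_derive_Reals. }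
  assert (Cg2 : forall x, continuous g2 x).
  { intros x. apply (ex_derive_continuous (V := R_NormedModule)). exists (d2 x). now apply is_derive_Reals. }
  assert (Ccl : forall p : R * R, continuous (fun p : R * R => cl (snd p)) p).
  { intros p. apply continuous_clamp, continuous_snd'. }
  assert (Clam : forall p : R * R, continuous (fun p : R * R => lam (snd p)) p).
  { intros p. apply continuous_Rabs_fun, continuous_Rminus; [apply continuous_snd'|apply Ccl]. }
  (* Reversing a chord of length zero adds [k] to th, that is 1/2 to th / (2 k). At equal depth the
     two collars thus differ by exactly 1/2 in [u]. *)
  assert (Ends : forall t, t = 0 \/ t = 1 -> forall s, - INR M <= s <= INR M ->
     th s t / (2 * k) = th s 0 / (2 * k) + t / 2).
  { intros t [-> | ->] s Hs.
    - field. exact Kn.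
    - assert (E := R1 s 0 ltac:(lra) ltac:(lra)).
      rewrite Rplus_0_r, Rminus_0_r in E. rewrite E. field. exact Kn. }
  assert (Bd : forall t, 0 <= t <= 1 -> - (INR M - 1) <= th 0 t / (2 * k) <= INR M - 1).
  { intros t Hi. specialize (HB t Hi).
    assert (E : th 0 t / (2 * k) * (2 * k) = th 0 t) by (field; exact Kn).
    assert (A : Rabs (th 0 t / (2 * k)) <= INR M - 1).
    { assert (A1 := Rabs_mult (th 0 t / (2 * k)) (2 * k)). rewrite E in A1.
      rewrite (Rabs_mult 2 k), (Rabs_pos_eq 2) in A1 by lra.
      assert (A2 := Rabs_pos (th 0 t / (2 * k))). nra. }
    unfold Rabs in A. destruct Rcase_abs in A; lra. }
  destruct (level_crossing u L c M) as (s & t1 & t2 & Hs & Ht1 & Ht2 & U1 & U2 & EL).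
  - intros p. unfold u. apply continuous_Rplus; apply continuous_Rmult.
    + apply continuous_Rminus; [apply continuous_const|apply Clam].
    + apply continuous_Rmult; [|apply continuous_const].
      apply continuous_comp2; [exact Ct|apply continuous_fst'|apply Ccl].
    + apply Clam.
    + apply continuous_Rplus; [apply continuous_fst'|].
      apply continuous_Rmult; [apply Ccl|apply continuous_const].
  - intros p. unfold L, len. apply continuous_Rminus; [|apply Clam].
    apply continuous_Rplus; apply continuous_Rabs_fun; apply continuous_Rminus;
      ((apply (continuous_comp _ g1); [|apply Cg1]) || (apply (continuous_comp _ g2); [|apply Cg2]));
      try apply continuous_Rplus; try apply continuous_fst'; apply Ccl.
  - exact HM1.
  - lra.
  - intros s. unfold u, lam, cl.
    replace (clamp 0 1 (-1)) with 0 by (unfold clamp, Rmax, Rmin; repeat destruct Rle_dec; lra).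
    rewrite Rminus_0_r, Rabs_left by lra. field. exact Kn.
  - intros s. unfold u, lam, cl.
    replace (clamp 0 1 2) with 1 by (unfold clamp, Rmax, Rmin; repeat destruct Rle_dec; lra).
    rewrite Rabs_pos_eq by lra. field. exact Kn.
  - intros s. unfold L, lam, cl.
    replace (clamp 0 1 (-1)) with 0 by (unfold clamp, Rmax, Rmin; repeat destruct Rle_dec; lra).
    rewrite Len0, Rminus_0_r, Rabs_left by lra. ring.
  - intros s. unfold L, lam, cl.
    replace (clamp 0 1 2) with 1 by (unfold clamp, Rmax, Rmin; repeat destruct Rle_dec; lra).
    rewrite Len1, Rabs_pos_eq by lra. ring.
  - intros s t Hi. unfold L. specialize (Hlen s (cl t)). specialize (Hlam t). lra.
  (* At s = [INR M] both interpolated terms are at least 1: the first because th / (2 k) has grown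
     by [INR M] from a value not below 1 - [INR M]. *)
  - intros t Hi. unfold u.
    rewrite (proj1 (Tr (cl t) (Hcl t))). specialize (Bd (cl t) (Hcl t)). specialize (Hcl t).
    destruct (Hlam t) as (L0 & L1 & _). specialize (L1 Hi).
    replace ((th 0 (cl t) + 2 * k * INR M) / (2 * k)) with (th 0 (cl t) / (2 * k) + INR M)
      by (field; exact Kn).
    assert (A : 1 <= (1 - lam t) * (th 0 (cl t) / (2 * k) + INR M) + lam t * (INR M + cl t / 2)).
    { assert ((1 - lam t) * 1 <= (1 - lam t) * (th 0 (cl t) / (2 * k) + INR M))
        by (apply Rmult_le_compat_l; lra).
      assert (lam t * 1 <= lam t * (INR M + cl t / 2)) by (apply Rmult_le_compat_l; lra). lra. }
    lra.
  - intros t Hi. unfold u.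
    rewrite (proj2 (Tr (cl t) (Hcl t))). specialize (Bd (cl t) (Hcl t)). specialize (Hcl t).
    destruct (Hlam t) as (L0 & L1 & _). specialize (L1 Hi).
    replace ((th 0 (cl t) - 2 * k * INR M) / (2 * k)) with (th 0 (cl t) / (2 * k) - INR M)
      by (field; exact Kn).
    assert ((1 - lam t) * (th 0 (cl t) / (2 * k) - INR M) <= (1 - lam t) * (- / 2))
      by (apply Rmult_le_compat_l; lra).
    assert (lam t * (- INR M + cl t / 2) <= lam t * (- / 2)) by (apply Rmult_le_compat_l; lra).
    lra.
  - assert (Pos : forall t, cl t <> 0 -> cl t <> 1 -> 0 < len s (cl t)).
    { intros t N0 N1. assert (H := Hcl t).
      destruct (Req_dec (len s (cl t)) 0) as [E|E]; [exfalso|specialize (Hlen s (cl t)); lra].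
      unfold len in E.
      assert (A1 := Rabs_pos (g1 (s + cl t) - g1 s)).
      assert (A2 := Rabs_pos (g2 (s + cl t) - g2 s)).
      apply (injective_modulo_period g1 g2 s (cl t)); auto; [lra| |].
      - apply Rminus_diag_uniq. apply Rabs_eq_0. lra.
      - apply Rminus_diag_uniq. apply Rabs_eq_0. lra. }
    assert (End0 : forall t, cl t = 0 \/ cl t = 1 -> len s (cl t) = 0).
    { intros t [-> | ->]; auto. }
    assert (Dec : forall t, (cl t = 0 \/ cl t = 1) \/ (cl t <> 0 /\ cl t <> 1)).
    { intros t. destruct (Req_dec (cl t) 0), (Req_dec (cl t) 1); tauto. }
    unfold L in EL.
    assert (Hin1 := Dec t1). assert (Hin2 := Dec t2).
    destruct (Hlam t1) as [La1 _]. destruct (Hlam t2) as [La2 _].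
    destruct Hin1 as [I1|[N1 N1']], Hin2 as [I2|[N2 N2']].
    + (* Both points lie on the collar where no chord is involved; there the
         two values of [u] can only differ by a multiple of [1/2]. *)
      exfalso. rewrite !End0 in EL by assumption.
      unfold u in U1, U2. rewrite Ends in U1, U2 by assumption.
      replace (lam t1) with (lam t2) in U1 by lra.
      assert (c = (cl t2 - cl t1) / 2) by (rewrite <- U2; lra).
      destruct I1 as [E1|E1], I2 as [E2|E2]; rewrite E1, E2 in *; lra.
    (* One point on the collar and one proper chord: [L] is at most 0 at the first and positive at
       the second. *)
    + exfalso. rewrite (End0 t1 I1), (Hout t2 N2 N2') in EL.
      specialize (Pos t2 N2 N2'). lra.
    + exfalso. rewrite (End0 t2 I2), (Hout t1 N1 N1') in EL.
      specialize (Pos t1 N1 N1'). lra.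
    (* Two proper chords from s, with angles 0 and PI/2; equality of [L] is equality of their
       lengths, and this common length is the [r] sought. *)
    + rewrite (Hout t1 N1 N1'), (Hout t2 N2 N2') in EL.
      unfold u in U1, U2. rewrite (Hout t1 N1 N1') in U1. rewrite (Hout t2 N2 N2') in U2.
      assert (A1 : th s (cl t1) = 0).
      { replace (th s (cl t1)) with (2 * k * (th s (cl t1) / (2 * k))) by (field; exact Kn). nra. }
      assert (A2 : th s (cl t2) = PI / 2).
      { replace (th s (cl t2)) with (2 * k * (th s (cl t2) / (2 * k))) by (field; exact Kn).
        replace (th s (cl t2) / (2 * k)) with c by lra. unfold c. field. exact Kn. }
      assert (T1 := Hcl t1). assert (T2 := Hcl t2).
      assert (Q1 : 0 < cl t1 * (1 - cl t1)) by (apply Rmult_lt_0_compat; lra).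
      assert (Q2 : 0 < cl t2 * (1 - cl t2)) by (apply Rmult_lt_0_compat; lra).
      destruct (Ht s (cl t1) ltac:(lra) T1) as (r1 & Hr1 & X1 & Y1).
      destruct (Ht s (cl t2) ltac:(lra) T2) as (r2 & Hr2 & X2 & Y2).
      rewrite A1, cos_0, sin_0 in *. rewrite A2, cos_PI2, sin_PI2 in *.
      assert (GX1 := chord_spec g1 d1 P1 s (cl t1)). assert (GY1 := chord_spec g2 d2 P2 s (cl t1)).
      assert (GX2 := chord_spec g1 d1 P1 s (cl t2)). assert (GY2 := chord_spec g2 d2 P2 s (cl t2)).
      fold wx in GX1, GX2. fold wy in GY1, GY2.
      rewrite X1 in GX1. rewrite X2 in GX2. rewrite Y1 in GY1. rewrite Y2 in GY2.
      unfold len in EL. rewrite <- GX1, <- GX2, <- GY1, <- GY2 in EL.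
      rewrite !Rmult_0_r, !Rabs_R0, !Rmult_1_r, !Rabs_pos_eq in EL by nra.
      exists s, (s + cl t1), (s + cl t2), (cl t1 * (1 - cl t1) * r1).
      split; [now apply Rmult_lt_0_compat|]. repeat split; lra.
Qed.

(** * Reduction of an arbitrary triangle to the right isosceles one *)

Theorem mainTheorem1 (Gamma : point -> Prop) (A B C : point) :
  jordan_C1_curve Gamma -> ~ flat A B C ->
  exists (v c : point) (r : R), 0 < r /\
    Gamma (homothety c r (translation v A)) /\
    Gamma (homothety c r (translation v B)) /\
    Gamma (homothety c r (translation v C)).
Proof.
  intros (g1 & g2 & (Hper & (d1 & d2 & D1 & D2 & Cd1 & Cd2 & Hn) & Hinj) & HG) Hflat.
  destruct A as [ax ay], B as [bx by0], C as [cx cy].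
  set (ex := bx - ax). set (ey := by0 - ay). set (fx := cx - ax). set (fy := cy - ay).
  assert (Hdet : ex * fy - ey * fx <> 0).
  { intros Hz. apply Hflat. unfold flat, on_line; cbn [fst snd].
    (* If the determinant vanishes, the common line passes through A with direction AB, or AC when A
       = B; if moreover C has the abscissa of A, the vertical line through A serves. *)
    destruct (Req_dec ex 0) as [E1|N1]; [destruct (Req_dec ey 0) as [E2|N2]|].
    - destruct (Req_dec fx 0) as [E3|N3].
      + exists 1, 0, ax. unfold ex, fx in *. lra.
      + exists fy, (- fx), (fy * ax - fx * ay).
        unfold ex, ey, fx, fy in *. split; [right; lra|]. repeat split; nra.
    - exists ey, (- ex), (ey * ax - ex * ay). unfold ex, ey, fx, fy in *.
      split; [left; lra|]. repeat split; nra.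
    - exists ey, (- ex), (ey * ax - ex * ay). unfold ex, ey, fx, fy in *.
      split; [right; lra|]. repeat split; nra. }
  set (D := ex * fy - ey * fx) in *.
  (* In the basis (AB, AC) the triangle becomes a right isosceles one. *)
  pose (x := fun (p q : R) => (p * fy - q * fx) / D).
  pose (y := fun (p q : R) => (q * ex - p * ey) / D).
  assert (Px : forall p q, p = x p q * ex + y p q * fx)
    by (intros; unfold x, y, D in *; field; exact Hdet).
  assert (Py : forall p q, q = x p q * ey + y p q * fy)
    by (intros; unfold x, y, D in *; field; exact Hdet).
  (* An invertible linear map preserves periodicity, regularity, nonzero velocity and injectivity,
     so the curve read in the new coordinates is again admissible. *)
  destruct (inscribed_corner (fun t => x (g1 t) (g2 t)) (fun t => y (g1 t) (g2 t)))
    as (s & t1 & t2 & r & Hr & E1 & E2 & E3 & E4).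
  { split; [|split].
    - intros t. destruct (Hper t) as [-> ->]. auto.
    - exists (fun t => x (d1 t) (d2 t)), (fun t => y (d1 t) (d2 t)).
      assert (Lin : forall a b t, derivable_pt_lim (fun t => (g1 t * a - g2 t * b) / D) t
                      ((d1 t * a - d2 t * b) / D)).
      { intros a b t. apply is_derive_Reals.
        apply (is_derive_ext (fun t => / D * a * g1 t - / D * b * g2 t)).
        - intros z. change (/ D * a * g1 z - / D * b * g2 z = (g1 z * a - g2 z * b) * / D). ring.
        - replace ((d1 t * a - d2 t * b) / D) with (/ D * a * d1 t - / D * b * d2 t)
            by (unfold Rdiv; ring).
          apply is_derive_Reals.
          apply (derivable_pt_lim_minus (fun t => / D * a * g1 t) (fun t => / D * b * g2 t));
            now apply derivable_pt_lim_scal. }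
      assert (LinC : forall (h k : R -> R) a b, continuity h -> continuity k ->
                continuity (fun t => (h t * a - k t * b) / D)).
      { intros h k a b Ch Ck t.
        apply continuity_pt_filterlim.
        apply continuous_Rmult; [|apply continuous_const].
        apply continuous_Rminus; apply continuous_Rmult; try apply continuous_const;
          apply continuity_pt_filterlim; auto. }
      split; [|split; [|split; [|split]]].
      + intros t. apply Lin.
      + intros t. apply is_derive_Reals.
        apply (is_derive_ext (fun t => (g1 t * (- ey) - g2 t * (- ex)) / D)).
        * intros z. change ((g1 z * - ey - g2 z * - ex) / D = (g2 z * ex - g1 z * ey) / D).
          unfold Rdiv. ring.
        * replace (y (d1 t) (d2 t)) with ((d1 t * (- ey) - d2 t * (- ex)) / D)
            by (unfold y, Rdiv; ring).
          apply is_derive_Reals, Lin.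
      + now apply LinC.
      + now apply LinC.
      + intros t. destruct (Req_dec (x (d1 t) (d2 t)) 0) as [E|]; [right|now left].
        intros E'. destruct (Hn t) as [H|H]; apply H.
        * rewrite (Px (d1 t) (d2 t)), E, E'. ring.
        * rewrite (Py (d1 t) (d2 t)), E, E'. ring.
    - intros s t Hs Ht E E'. apply Hinj; try assumption.
      + rewrite (Px (g1 s) (g2 s)), E, E', <- Px. reflexivity.
      + rewrite (Py (g1 s) (g2 s)), E, E', <- Py. reflexivity. }
  cbv beta in *.
  (* The homothety is centred at the origin. The translation is chosen so that A is sent to the
     curve point of parameter [s]; then B and C go to this point plus r AB and r AC. *)
  exists (g1 s / r - ax, g2 s / r - ay), (0, 0), r. split; [exact Hr|].
  assert (Q1 := Px (g1 s) (g2 s)). assert (Q2 := Py (g1 s) (g2 s)).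
  assert (F1 : g1 t1 = g1 s + r * ex)
    by (assert (Q := Px (g1 t1) (g2 t1)); rewrite E1, E2 in Q; lra).
  assert (F2 : g2 t1 = g2 s + r * ey)
    by (assert (Q := Py (g1 t1) (g2 t1)); rewrite E1, E2 in Q; lra).
  assert (F3 : g1 t2 = g1 s + r * fx)
    by (assert (Q := Px (g1 t2) (g2 t2)); rewrite E3, E4 in Q; lra).
  assert (F4 : g2 t2 = g2 s + r * fy)
    by (assert (Q := Py (g1 t2) (g2 t2)); rewrite E3, E4 in Q; lra).
  unfold homothety, translation, padd, pscale, psub; cbn [fst snd].
  split; [|split]; apply HG; [exists s|exists t1|exists t2]; f_equal;
    rewrite ?F1, ?F2, ?F3, ?F4; unfold ex, ey, fx, fy; field; lra.
Qed.
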